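(* Let $F=\overline{\mathbb{F}_2}$ be an algebraic closure of the field with two elements, let $$R=\frac{F[x,y,z,t]}{\bigl(tz^4+(x^2+yz)(y^2+xz)\bigr)},$$ let $I=(x^4,y^4,z^4)\subseteq R$, and let $S=F[t]\setminus\{0\}$. Then $y^3z^3\in (S^{-1}I)^*$ and $y^3z^3\notin S^{-1}(I^* )$, where $(S^{-1}I)^*$ denotes the tight closure in $S^{-1}R$ of the ideal $S^{-1}I=I\cdot S^{-1}R$, and $I^*$ denotes the tight closure of $I$ in $R$. In particular tight closure of $I$ does not commute with localization at $S$.
   Context: For a noetherian domain $A$ of prime characteristic $p>0$ and an ideal $J\subseteq A$, write $J^{[p^e]}=\langle x^{p^e}\mid x\in J\rangle$. An element $r\in A$ is in the tight closure $J^*$ of $J$ if there exists $0\neq c\in A$ such that $c\,r^{p^e}\in J^{[p^e]}$ for all $e\ge 1$. *)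

(* Defs.v *)
From HB Require Import structures.
From mathcomp Require Import all_boot all_order all_algebra.
From mathcomp Require Import generic_quotient ring_quotient ring.
From mathcomp Require Import mpoly.
From mathcomp Require Import boolp classical_sets.

Set Implicit Arguments.
Unset Strict Implicit.
Unset Printing Implicit Defensive.

Import GRing.Theory.
Local Open Scope ring_scope.
Local Open Scope quotient_scope.
Local Open Scope classical_set_scope.

Section TightClosure.
Variable A : comPzRingType.

Definition ideal_gen (X : set A) : set A :=
  [set a | exists (n : nat) (c g : 'I_n -> A),
     (forall i, X (g i)) /\ a = \sum_(i < n) c i * g i].

Definition bracket_power (q : nat) (J : set A) : set A :=
  ideal_gen [set x ^+ q | x in J].

(* For A of characteristic p; the definition itself only uses p as an exponent. *)
Definition tight_closure (p : nat) (J : set A) : set A :=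
  [set r | exists c : A, c != 0 /\
     forall e : nat, (1 <= e)%N -> bracket_power (p ^ e)%N J (c * r ^+ (p ^ e)%N)].

End TightClosure.

Section Localization.
Variables (A : comPzRingType) (S : mulrClosed A).

Record preloc := Preloc { preloc_pair :> A * A; _ : preloc_pair.2 \in S }.

HB.instance Definition _ := [isSub for preloc_pair].
HB.instance Definition _ := [Choice of preloc by <:].

Implicit Types x y z : preloc.

Lemma preloc_den x : x.2 \in S. Proof. by case: x. Qed.

Definition mkpreloc (a s : A) (hs : s \in S) : preloc := @Preloc (a, s) hs.

(* a / s = b / t iff u (a t - b s) = 0 for some u in S; no domain assumption. *)
Definition loc_equiv x y : bool :=
  `[< exists2 u, u \in S & u * (x.1 * y.2 - y.1 * x.2) = 0 >].

Lemma loc_equivP x y :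
  reflect (exists2 u, u \in S & u * (x.1 * y.2 - y.1 * x.2) = 0)
          (loc_equiv x y).
Proof. exact: asboolP. Qed.

Lemma loc_equiv_refl : reflexive loc_equiv.
Proof. by move=> x; apply/loc_equivP; exists 1; rewrite ?rpred1 // subrr mulr0. Qed.

Lemma loc_equiv_sym : ssrbool.symmetric loc_equiv.
Proof.
move=> x y; apply/loc_equivP/loc_equivP => -[u uS e]; exists u => //.
  by rewrite -opprB mulrN e oppr0.
by rewrite -opprB mulrN e oppr0.
Qed.

Lemma loc_equiv_trans : transitive loc_equiv.
Proof.
move=> y x z /loc_equivP[u uS e] /loc_equivP[v vS f]; apply/loc_equivP.
exists (u * v * y.2); first by rewrite !rpredM // preloc_den.
transitivity (v * z.2 * (u * (x.1 * y.2 - y.1 * x.2)) +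
              u * x.2 * (v * (y.1 * z.2 - z.1 * y.2))); first by ring.
by rewrite e f !mulr0 addr0.
Qed.

Canonical loc_equiv_equiv :=
  EquivRel loc_equiv loc_equiv_refl loc_equiv_sym loc_equiv_trans.

Definition loc := {eq_quot loc_equiv}.

HB.instance Definition _ : EqQuotient _ loc_equiv loc := EqQuotient.on loc.
HB.instance Definition _ := Choice.on loc.

Lemma loc_eqP x y :
  reflect (exists2 u, u \in S & u * (x.1 * y.2 - y.1 * x.2) = 0)
          (x == y %[mod loc]).
Proof. by rewrite eqmodE; apply: loc_equivP. Qed.

Lemma loc_repr x :
  exists2 u, u \in S & u * ((repr (\pi_loc x)).1 * x.2 - x.1 * (repr (\pi_loc x)).2) = 0.
Proof. by apply/loc_eqP; rewrite reprK. Qed.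

Lemma preloc_denM x y : x.2 * y.2 \in S.
Proof. by rewrite rpredM // preloc_den. Qed.

Definition embed_pre (a : A) := mkpreloc a (rpred1 S).
Definition addp x y := mkpreloc (x.1 * y.2 + y.1 * x.2) (preloc_denM x y).
Definition oppp x := mkpreloc (- x.1) (preloc_den x).
Definition mulp x y := mkpreloc (x.1 * y.1) (preloc_denM x y).

Definition loc_of := lift_embed loc embed_pre.
Canonical loc_of_pi_morph := PiEmbed loc_of.

Definition loc_add := lift_op2 loc addp.
Definition loc_opp := lift_op1 loc oppp.
Definition loc_mul := lift_op2 loc mulp.

Lemma pi_loc_add : {morph \pi : x y / addp x y >-> loc_add x y}.
Proof.
move=> x y; unlock loc_add; apply/esym/eqP/loc_eqP.
have [u uS e] := loc_repr x; have [v vS f] := loc_repr y.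
set x' := repr _ in e *; set y' := repr _ in f *.
exists (u * v); first by rewrite rpredM.
rewrite /=.
transitivity (v * y'.2 * y.2 * (u * (x'.1 * x.2 - x.1 * x'.2)) +
              u * x'.2 * x.2 * (v * (y'.1 * y.2 - y.1 * y'.2))); first by ring.
by rewrite e f !mulr0 addr0.
Qed.
Canonical pi_loc_add_morph := PiMorph2 pi_loc_add.

Lemma pi_loc_opp : {morph \pi : x / oppp x >-> loc_opp x}.
Proof.
move=> x; unlock loc_opp; apply/esym/eqP/loc_eqP.
have [u uS e] := loc_repr x; exists u => //=.
by rewrite !mulNr -opprD mulrN e oppr0.
Qed.
Canonical pi_loc_opp_morph := PiMorph1 pi_loc_opp.

Lemma pi_loc_mul : {morph \pi : x y / mulp x y >-> loc_mul x y}.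
Proof.
move=> x y; unlock loc_mul; apply/esym/eqP/loc_eqP.
have [u uS e] := loc_repr x; have [v vS f] := loc_repr y.
set x' := repr _ in e *; set y' := repr _ in f *.
exists (u * v); first by rewrite rpredM.
rewrite /=.
transitivity (v * y'.1 * y.2 * (u * (x'.1 * x.2 - x.1 * x'.2)) +
              u * x.1 * x'.2 * (v * (y'.1 * y.2 - y.1 * y'.2))); first by ring.
by rewrite e f !mulr0 addr0.
Qed.
Canonical pi_loc_mul_morph := PiMorph2 pi_loc_mul.

Lemma loc_eq_cross x y : x.1 * y.2 = y.1 * x.2 -> x = y %[mod loc].
Proof.
by move=> e; apply/eqP/loc_eqP; exists 1; rewrite ?rpred1 // e subrr mulr0.
Qed.

Lemma loc_addA : associative loc_add.
Proof.
elim/quotW=> x; elim/quotW=> y; elim/quotW=> z; rewrite !piE.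
by apply: loc_eq_cross => /=; ring.
Qed.

Lemma loc_addC : commutative loc_add.
Proof.
elim/quotW=> x; elim/quotW=> y; rewrite !piE.
by apply: loc_eq_cross => /=; ring.
Qed.

Lemma loc_add0 : left_id (loc_of 0) loc_add.
Proof.
by elim/quotW=> x; rewrite !piE; apply: loc_eq_cross => /=; ring.
Qed.

Lemma loc_addN : left_inverse (loc_of 0) loc_opp loc_add.
Proof.
by elim/quotW=> x; rewrite !piE; apply: loc_eq_cross => /=; ring.
Qed.

HB.instance Definition _ :=
  GRing.isZmodule.Build loc loc_addA loc_addC loc_add0 loc_addN.

Lemma loc_mulA : associative loc_mul.
Proof.
elim/quotW=> x; elim/quotW=> y; elim/quotW=> z; rewrite !piE.
by apply: loc_eq_cross => /=; ring.
Qed.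

Lemma loc_mulC : commutative loc_mul.
Proof.
elim/quotW=> x; elim/quotW=> y; rewrite !piE.
by apply: loc_eq_cross => /=; ring.
Qed.

Lemma loc_mul1 : left_id (loc_of 1) loc_mul.
Proof.
by elim/quotW=> x; rewrite !piE; apply: loc_eq_cross => /=; ring.
Qed.

Lemma loc_mulDl : left_distributive loc_mul loc_add.
Proof.
elim/quotW=> x; elim/quotW=> y; elim/quotW=> z; rewrite !piE.
by apply: loc_eq_cross => /=; ring.
Qed.

HB.instance Definition _ :=
  GRing.Zmodule_isComPzRing.Build loc loc_mulA loc_mulC loc_mul1 loc_mulDl.

Lemma loc_of_is_zmod_morphism : zmod_morphism loc_of.
Proof.
move=> a b; rewrite -[RHS]/(loc_add (loc_of a) (loc_opp (loc_of b))) !piE.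
by apply: loc_eq_cross => /=; ring.
Qed.

HB.instance Definition _ :=
  GRing.isZmodMorphism.Build A loc loc_of loc_of_is_zmod_morphism.

Lemma loc_of_is_monoid_morphism : monoid_morphism loc_of.
Proof.
split=> // a b; rewrite [RHS]/GRing.mul /= !piE.
by apply: loc_eq_cross => /=; ring.
Qed.

HB.instance Definition _ :=
  GRing.isMonoidMorphism.Build A loc loc_of loc_of_is_monoid_morphism.

(* J . S^-1 A; when J is an ideal this is the set of all a / s with a in J. *)
Definition loc_ideal (J : set A) : set loc := ideal_gen (loc_of @` J).

End Localization.

Section Ring.
Variable F : fieldType.

(* The variables 'X_0, 'X_1, 'X_2, 'X_3 stand for x, y, z, t. *)
Definition polX : {mpoly F[4]} := 'X_(@Ordinal 4 0 isT).
Definition polY : {mpoly F[4]} := 'X_(@Ordinal 4 1 isT).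
Definition polZ : {mpoly F[4]} := 'X_(@Ordinal 4 2 isT).
Definition polT : {mpoly F[4]} := 'X_(@Ordinal 4 3 isT).

Definition rel_pol : {mpoly F[4]} :=
  polT * polZ ^+ 4 + (polX ^+ 2 + polY * polZ) * (polY ^+ 2 + polX * polZ).

Definition rel_ideal : {pred {mpoly F[4]}} :=
  fun p => `[< exists q, p = q * rel_pol >].

Lemma rel_ideal_closed : idealr_closed rel_ideal.
Proof.
split.
- by apply/asboolP; exists 0; rewrite mul0r.
- apply/asboolP => -[q /(congr1 (meval (fun _ : 'I_4 => 0 : F)))].
  rewrite meval1 mevalM.
  have -> : rel_pol.@[fun=> 0] = 0.
    by rewrite /rel_pol /polX /polY /polZ /polT
       !(mevalD, mevalM) !mevalXU !(mul0r, addr0).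
  by rewrite mulr0 => /eqP; rewrite oner_eq0.
- move=> a u v /asboolP[q ->] /asboolP[r ->]; apply/asboolP.
  by exists (a * q + r); rewrite mulrDl mulrA.
Qed.

HB.instance Definition _ := isIdealr.Build _ rel_ideal rel_ideal_closed.

Definition hypR : comNzRingType := {ideal_quot rel_ideal}.

Definition toR (p : {mpoly F[4]}) : hypR := \pi_{ideal_quot rel_ideal} p.

Definition Rx : hypR := toR polX.
Definition Ry : hypR := toR polY.
Definition Rz : hypR := toR polZ.

Definition idealI : set hypR := ideal_gen [set Rx ^+ 4; Ry ^+ 4; Rz ^+ 4].

(* S = F[t] \ {0}: the classes in R of g(t) for nonzero g in F[T]. *)
Definition multS : {pred hypR} :=
  fun r => `[< exists2 g : {poly F}, g != 0 &
               r = toR (map_poly (@mpolyC 4 F) g).[polT] >].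

Lemma multS_closed : GRing.mulr_closed multS.
Proof.
split.
  apply/asboolP; exists 1; first exact: oner_neq0.
  by rewrite rmorph1 hornerC /toR rmorph1.
move=> a b /asboolP[g g0 ->] /asboolP[h h0 ->]; apply/asboolP.
exists (g * h); first by rewrite mulf_neq0.
by rewrite rmorphM hornerM /toR rmorphM.
Qed.

HB.instance Definition _ := GRing.isMulClosed.Build _ multS multS_closed.

End Ring.

Arguments multS : clear implicits.
Arguments idealI : clear implicits.
Arguments Rx {F}.
Arguments Ry {F}.
Arguments Rz {F}.
Arguments loc_of {A} S _.
Arguments loc_ideal {A} S _ _.

(* Main.v *)
From HB Require Import structures.
Require Import Defs.
From mathcomp Require Import all_boot all_order all_algebra.
From mathcomp Require Import generic_quotient ring_quotient ring zify mpoly.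
From mathcomp Require Import boolp classical_sets.

Set Implicit Arguments.
Unset Strict Implicit.
Unset Printing Implicit Defensive.
Import GRing.Theory.
Local Open Scope ring_scope.
Local Open Scope quotient_scope.

(* Put X = x^2+yz and Y = y^2+xz, so that XY = t z^4 and, for M = 2^e,
   x^{4M} = X^{2M} + Y^M z^{2M} + x^M z^{3M}, and symmetrically for y^{4M}.

   Membership after localization (multiplier z): modulo t the product XY vanishes, and the
   above expansions show by induction on the exponent that z times every monomial of degree
   6M in X, Y, z (where z has degree 1 and X, Y degree 2) lies in (x^{4M}, y^{4M}, z^{4M}) + (t).
   A determinant then gives w in F[t] with w(0) = 1 and
   w z (y^3 z^3)^M in (x^{4M}, y^{4M}, z^{4M}).

   Failure before localization: specialize t = s^2 and write X = s u^4, Y = s v^4, z = u v, so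
   that the ring becomes a subring of a free F[u,v]-algebra with basis 1, x, y, xy.  For
   infinitely many s there is a syzygy of (x^{4m}, y^{4m}, z^{4m}), m = 4^K, of degree less
   than 6m, the degree of a balanced pair of syzygies.  Its Frobenius powers show that
   c (y^3 z^3)^M can lie in (x^{4M}, y^{4M}, z^{4M}), M = m q, only if c is in (u^q, v^q);
   hence no nonzero c works for every q, and the infinitely many values of s rule out a
   multiplier in F[t] \ {0}. *)

(** * Regular sequences of length two *)

(** The two halves differ in uniformity. The element w depends on M, which is harmless after
    localization: w becomes a unit there, and only z has to serve for every exponent. In R a single
    multiplier must serve for all exponents on every fiber. The special values of s come from a
    scalar lam carried by the construction of the syzygy, which multiplies M by four at each stage.
    The first stage starts with lam = s^4. The final argument needs lam = 1, so that one pair is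
    good for powers of u and of v at once. Read backwards from 1, the recursion for lam is the
    iteration of nu |-> (nu + s^2 / nu)^4 up to Frobenius, and the condition becomes nu_N(s) = s,
    which has a root since F is algebraically closed. A root at one level makes the next iterate
    vanish in characteristic 2, so distinct levels have distinct roots. The square t = s^2 is what
    allows XY = t z^4 to be parametrized by monomials in u and v. *)

Section RegularPair.
Variable A : comNzRingType.
Implicit Types u v w : A.

Definition divides (a b : A) : Prop := exists c, b = a * c.

(** Only this much arithmetic of u and v is used. It passes coordinatewise to the free extension
    [qext], so neither integrality nor factoriality of that ring has to be discussed. *)
Definition regular_pair u v : Prop :=
  [/\ forall w, u * w = 0 -> w = 0, forall w, v * w = 0 -> w = 0
    & forall w, divides v (u * w) -> divides v w].

Lemma regular_pair_sym u v : regular_pair u v -> regular_pair v u.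
Proof.
move=> [ru rv uv]; split=> // w [c e].
have [d ed] : divides v c by apply: uv; exists w.
exists d; apply/eqP; rewrite -subr_eq0; apply/eqP/rv.
by rewrite mulrBr e ed mulrCA subrr.
Qed.

Lemma regular_exp u k : (forall w, u * w = 0 -> w = 0) ->
  forall w, u ^+ k * w = 0 -> w = 0.
Proof.
move=> ru w; elim: k => [|k IH]; first by rewrite mul1r.
by rewrite exprS -mulrA => /ru.
Qed.

Lemma regular_pair_exp u v k l w : regular_pair u v ->
  divides (v ^+ l) (u ^+ k * w) -> divides (v ^+ l) w.
Proof.
move=> [ru rv uv]; elim: l w => [|l IH] w; first by exists w; rewrite mul1r.
have step j w' : divides v (u ^+ j * w') -> divides v w'.
  by elim: j => [|j IHj]; [rewrite mul1r | rewrite exprS -mulrA => /uv].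
move=> [c e]; have [w1 ew] : divides v w.
  by apply: (step k); exists (v ^+ l * c); rewrite e exprS mulrA.
have [d ed] : divides (v ^+ l) w1.
  apply: IH; exists c; apply/eqP; rewrite -subr_eq0; apply/eqP/rv.
  by rewrite mulrBr mulrCA -ew e exprS mulrA subrr.
by exists d; rewrite ew ed exprS mulrA.
Qed.

Lemma regular_pair_lcm u v k l w : regular_pair u v ->
  divides (u ^+ k) w -> divides (v ^+ l) w -> divides (u ^+ k * v ^+ l) w.
Proof.
move=> /regular_pair_sym r d [c e]; move: d; rewrite e => /(regular_pair_exp r)[d ->].
by exists d; rewrite mulrCA mulrA.
Qed.

(** As for monomials in two variables, the colon ideal of (u^(i+k), v^(j+l)) by u^i v^j is (u^k,
    v^l). *)
Lemma regular_pair_monomial u v i j k l w a b : regular_pair u v ->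
  u ^+ i * v ^+ j * w = u ^+ (i + k) * a + v ^+ (j + l) * b ->
  exists a' b', w = u ^+ k * a' + v ^+ l * b'.
Proof.
move=> r e; have [_ rv _] := r; have [ru _ _] := r.
have [b1 e1] : divides (v ^+ (j + l)) (v ^+ j * w - u ^+ k * a).
  apply: (regular_pair_exp (k := i) r); exists b.
  by rewrite mulrBr !mulrA -exprD e addrC addKr.
have [a1 e2] : divides (u ^+ k) (w - v ^+ l * b1).
  apply: (regular_pair_exp (k := j) (regular_pair_sym r)); exists a.
  by rewrite mulrBr mulrA -exprD -e1; ring.
by exists a1, b1; rewrite -e2 subrK.
Qed.

(** Modulo v the second factor is a unit times u^l, hence a nonzerodivisor, and the powers of v are
    stripped from E one at a time. *)
Lemma regular_pair_unit u v (k l : nat) (kap kap' eta E : A) :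
    regular_pair u v -> kap' * kap = 1 ->
  divides (v ^+ k) (E * (kap * u ^+ l + v * eta)) -> divides (v ^+ k) E.
Proof.
move=> r kk; have [ru rv uv] := r.
elim: k E => [|k IH] E; first by exists E; rewrite mul1r.
move=> [c e]; have [E1 eE] : divides v E.
  rewrite -(expr1 v); apply: (regular_pair_exp (k := l) r); rewrite expr1.
  exists (kap' * (v ^+ k * c - E * eta)).
  transitivity ((kap' * kap) * u ^+ l * E); first by rewrite kk mul1r.
  transitivity (kap' * (E * (kap * u ^+ l + v * eta) - v * E * eta)); first by ring.
  by rewrite e exprS; ring.
have [d ed] : divides (v ^+ k) E1.
  apply: IH; exists c; apply/eqP; rewrite -subr_eq0; apply/eqP/rv.
  by rewrite mulrBr !mulrA -eE e exprS subrr.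
by exists d; rewrite eE ed exprS mulrA.
Qed.

End RegularPair.

Section Char2.
Variable A : comNzRingType.
Hypothesis chA : 2%N \in [pchar A].

Lemma exprD_pow2 (a b : A) e :
  (a + b) ^+ (2 ^ e)%N = a ^+ (2 ^ e)%N + b ^+ (2 ^ e)%N.
Proof.
rewrite exprDn_pchar // (eq_pnat _ (pcharf_eq chA)).
by rewrite pnatX.
Qed.

Lemma exprD_pow4 (a b : A) e :
  (a + b) ^+ (4 ^ e)%N = a ^+ (4 ^ e)%N + b ^+ (4 ^ e)%N.
Proof. by rewrite (_ : 4 = 2 ^ 2)%N // -expnM exprD_pow2. Qed.

(** This is how identities special to characteristic 2 are given to [ring]: [c] collects the terms
    that occur twice, and what remains is an identity over the integers. *)
Lemma eq_mod2 (a b c : A) : a = b + (c + c) -> a = b.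
Proof. by rewrite (addrr_pchar2 chA) addr0. Qed.

End Char2.

(** Isolates u^M inside u^(kM) for a numeral k, so that [ring] can treat u^M as an atom. *)
Lemma exprMC (A : comNzRingType) (x : A) k m : x ^+ (k * m)%N = (x ^+ m) ^+ k.
Proof. by rewrite mulnC exprM. Qed.

(** * A syzygy of small degree *)

Section Destabilize.
Variable A : comNzRingType.
Hypothesis chA : 2%N \in [pchar A].
(** The hypotheses on [g] and [lam] express lam_n = lam_(n+1) + s^(2 4^(n+2)) / lam_(n+1) without
    division, with both end values prescribed; [destabilizing_chain] provides such data. *)
Variables (s s' : A) (N : nat) (g lam : nat -> A).
Hypothesis ss' : s' * s = 1.
Hypothesis lam0 : lam 0%N = s ^+ 4.
Hypothesis lamN : lam N = 1.
Hypothesis lam_g : forall n, (n < N)%N -> lam n.+1 * g n = s ^+ (4 ^ n.+2).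
Hypothesis lam_step : forall n, (n < N)%N ->
  lam n = lam n.+1 + g n * s ^+ (4 ^ n.+2).

(* fsum u v n = sum_{i <= n} s^{4^i} u^{2 4^i} v^{2 (4^n - 4^i)}, which is, up to
   a monomial factor, the X-part of y^{4^{n+1}}. *)
Fixpoint fsum (u v : A) n : A :=
  if n is n'.+1 then v ^+ (6 * 4 ^ n') * fsum u v n' + s ^+ (4 ^ n) * u ^+ (8 * 4 ^ n')
  else s * u ^+ 2.

(* For (a, b) = syz u v N and M = 4^{N+1}, the pair (u^3 v^{2M+3} a, u^{2M+3} v^3 b)
   is a syzygy of (x^{4M}, y^{4M}) modulo z^{4M}; see syz_divides_uv. *)
Fixpoint syz (u v : A) n : A * A :=
  if n is n'.+1 then
    let m := (4 ^ n)%N in let: (a, b) := syz u v n' in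
    (u ^+ (6 * m) * a + g n' * v ^+ (6 * m) * b,
     v ^+ (6 * m) * b + g n' * u ^+ (6 * m) * a)
  else (1, 1).

Lemma syz_swap u v n : syz v u n = ((syz u v n).2, (syz u v n).1).
Proof. by elim: n => [|n IH] //=; rewrite IH; case: (syz u v n). Qed.

(** With m = 4^(n+1), expand the next combination. The two terms in u^(14m) a cancel by [lam_g], the
    terms in v^(6m) u^(8m) b combine to the coefficient lam_n by [lam_step], and (uv)^(6m) times the
    previous combination appears. The one extra term carries v^(12m), more than is needed. *)
Lemma syz_divides u v n : (n <= N)%N ->
  divides (v ^+ (2 * 4 ^ n.+1 - 2))
    (fsum u v n.+1 * (syz u v n).1 + lam n * u ^+ (2 * 4 ^ n.+1) * (syz u v n).2).
Proof.
elim: n => [_|n IH ltnN].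
  exists (s * u ^+ 2); rewrite /= lam0 (_ : 2 * 4 ^ 1 - 2 = 6)%N //.
  by apply: (eq_mod2 chA (c := s ^+ 4 * u ^+ 8)); rewrite /=; ring.
have {IH} [e IH] := IH (ltnW ltnN).
have -> : fsum u v n.+2 = v ^+ (6 * 4 ^ n.+1) * fsum u v n.+1
    + s ^+ (4 ^ n.+2) * u ^+ (8 * 4 ^ n.+1) by [].
move: (fsum u v n.+1) IH (lam_g ltnN) (lam_step ltnN) => f.
rewrite /=; case: (syz u v n) => a b /= IH hg hl.
rewrite {}hl in IH.
rewrite !(expnS 4 n.+1).
set m := (4 ^ n.+1)%N in IH hg *.
have m0 : (0 < m)%N by rewrite expn_gt0.
rewrite expnS -/m in hg IH.
have eW : v ^+ (2 * (4 * m) - 2) = (v ^+ m) ^+ 6 * v ^+ (2 * m - 2).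
  by rewrite -exprM -exprD; congr (_ ^+ _); lia.
have eT : v ^+ (2 * m - 2) * v ^+ (4 * m + 2) = (v ^+ m) ^+ 6.
  by rewrite -exprM -exprD; congr (_ ^+ _); lia.
exists (u ^+ (6 * m) * e + g n * v ^+ (4 * m + 2) * f * b).
rewrite eW mulnA (_ : 2 * 4 = 8)%N // !exprMC in hg IH *.
move: (v ^+ (2 * m - 2)) (v ^+ (4 * m + 2)) (v ^+ m) (u ^+ m) (s ^+ m) eT hg IH.
move=> W T V U S eT hg IH {eW}.
apply: (eq_mod2 chA (c := S ^+ 4 * U ^+ 14 * a)).
transitivity (V ^+ 6 * U ^+ 6 * (W * e) + V ^+ 6 * (W * T) * g n * f * b
  + (S ^+ 4 + lam n.+1 * g n) * U ^+ 14 * a); last by rewrite hg; ring.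
by rewrite -IH eT; ring.
Qed.

Definition quadratic (u v x y : A) : Prop :=
  x ^+ 2 = s * u ^+ 4 + u * v * y /\ y ^+ 2 = s * v ^+ 4 + u * v * x.

Lemma quadratic_sym u v x y : quadratic u v x y -> quadratic v u y x.
Proof. by case=> e1 e2; split; rewrite (mulrC v u). Qed.

Lemma quadratic_pow4 u v x y e : quadratic u v x y ->
  let M := (2 ^ e)%N in
  y ^+ (4 * M) = (s ^+ M) ^+ 2 * (v ^+ M) ^+ 8 + s ^+ M * (u ^+ M) ^+ 6 * (v ^+ M) ^+ 2
                 + y ^+ M * (u ^+ M) ^+ 3 * (v ^+ M) ^+ 3.
Proof.
move=> [ex ey] M.
have e4 : y ^+ 4 = s ^+ 2 * v ^+ 8 + s * u ^+ 6 * v ^+ 2 + y * u ^+ 3 * v ^+ 3.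
  rewrite (exprM y 2 2) ey.
  apply: (eq_mod2 chA (c := s * v ^+ 4 * u * v * x)).
  transitivity (s ^+ 2 * v ^+ 8 + u ^+ 2 * v ^+ 2 * x ^+ 2
                + (s * v ^+ 4 * u * v * x + s * v ^+ 4 * u * v * x)); first by ring.
  by rewrite ex; ring.
have ac w k : (w ^+ k) ^+ M = (w ^+ M) ^+ k by rewrite exprAC.
rewrite exprM e4 !(exprD_pow2 chA) -/M (exprMn M _ (v ^+ 8)) (exprMn M _ (v ^+ 2)).
by rewrite (exprMn M _ (v ^+ 3)) (exprMn M s (u ^+ 6)) (exprMn M y (u ^+ 3)) !ac.
Qed.

(** The summands of [fsum] divisible by a high power of v; the one left out is a power of s times a
    power of u. *)
Definition fsum_low (u v : A) n : A :=
  if n is n'.+1 then v ^+ (6 * 4 ^ n') * fsum u v n' else 0.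

Lemma fsum_lowE u v n : fsum u v n = fsum_low u v n + s ^+ (4 ^ n) * u ^+ (2 * 4 ^ n).
Proof. by case: n => [|n] /=; rewrite ?add0r // expnS mulnA. Qed.

(** In [quadratic_pow4] only the term y^m u^(3m) v^(3m) involves y, so it carries the recursion.
    Multiplying by v^(4^n) allows the main part to be written with [fsum_low] without dividing by a
    power of v. *)
Lemma pow_y_mod_v u v x y n : quadratic u v x y ->
  exists e, v ^+ (4 ^ n) * y ^+ (4 ^ n)
            = u ^+ (4 ^ n) * fsum_low u v n + v ^+ (2 * 4 ^ n - 1) * e.
Proof.
move=> q; elim: n => [|n [e IH]].
  by exists y; rewrite /= !expr1 mulr0 add0r.
rewrite expnS /= fsum_lowE.
have /= := quadratic_pow4 (2 * n) q.
rewrite expnM (_ : 2 ^ 2 = 4)%N // => ->.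
have m0 : (0 < 4 ^ n)%N by rewrite expn_gt0.
move: (fsum_low u v n) (4 ^ n)%N m0 IH => f m m0 IH.
have eW : v ^+ (2 * (4 * m) - 1) = (v ^+ m) ^+ 6 * v ^+ (2 * m - 1).
  by rewrite -exprM -exprD; congr (_ ^+ _); lia.
have eT : v ^+ (2 * m - 1) * v ^+ (4 * m + 1) = (v ^+ m) ^+ 6.
  by rewrite -exprM -exprD; congr (_ ^+ _); lia.
exists (e * (u ^+ m) ^+ 3 + (s ^+ m) ^+ 2 * v ^+ (4 * m + 1)).
rewrite eW !exprMC.
move: (v ^+ (2 * m - 1)) (v ^+ (4 * m + 1)) (v ^+ m) (u ^+ m) (s ^+ m) (y ^+ m) eT IH.
move=> W T V U S Y eT IH {eW}.
transitivity (S ^+ 2 * V ^+ 6 * V ^+ 6 + V ^+ 6 * S * U ^+ 6 + (V * Y) * U ^+ 3 * V ^+ 6);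
  first by ring.
by rewrite IH -[X in _ * X + _ + _]eT; ring.
Qed.

Lemma syz_divides_v u v x y : quadratic u v x y -> regular_pair u v ->
  let M := (4 ^ N.+1)%N in
  divides (v ^+ (4 * M))
    (u ^+ 3 * v ^+ (2 * M + 3) * (syz u v N).1 * x ^+ (4 * M)
     + u ^+ (2 * M + 3) * v ^+ 3 * (syz u v N).2 * y ^+ (4 * M)).
Proof.
move=> q r M.
have ey := quadratic_pow4 (2 * N.+1) q.
have ex := quadratic_pow4 (2 * N.+1) (quadratic_sym q).
rewrite /= expnM (_ : 2 ^ 2 = 4)%N // -/M in ex ey.
have [e ee] := pow_y_mod_v N.+1 q; rewrite -/M in ee.
have [eps es] := syz_divides u v (leqnn N); rewrite lamN -/M mul1r in es.
have ef : exists f', fsum_low u v N.+1 ^+ 2 = (v ^+ M) ^+ 3 * f'.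
  exists (fsum u v N ^+ 2); rewrite /= exprMn -!exprM; congr (v ^+ _ * _).
  by rewrite /M expnS; lia.
have := fsum_lowE u v N.+1; rewrite -/M => eF.
rewrite ex ey {ex ey}.
have M4 : (4 <= M)%N by rewrite /M expnS leq_pmulr // expn_gt0.
case: ef => f'; move: (fsum_low u v N.+1) (fsum u v N.+1) eF ee es => phi f eF ee es ef.
case: (syz u v N) es => a b /= es.
have eW : v ^+ 2 * v ^+ (2 * M - 2) = (v ^+ M) ^+ 2.
  by rewrite -exprM -exprD; congr (_ ^+ _); lia.
have eW1 : v ^+ (2 * M - 1) = v * v ^+ (2 * M - 2).
  by rewrite -exprS; congr (_ ^+ _); lia.
rewrite eW1 in ee; rewrite !(exprD _ (2 * M)) !(exprMC _ 2 M) in es eF *.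
rewrite (exprMC v 4 M).
(* Multiply f a + u^(2M) b, the output of [syz_divides] at lam N = 1, by f = phi + s^M u^(2M). Since
   phi^2 is divisible by v^(3M), what remains is u^(2M) times this element, and u^(2M) cancels
   modulo powers of v. *)
have [d ed] : divides (v ^+ (2 * M - 2)) ((s ^+ M) ^+ 2 * (u ^+ M) ^+ 2 * a + b * f).
  apply: (regular_pair_exp (k := M * 2) r); rewrite exprM.
  exists (f * eps + v ^+ 2 * v ^+ M * f' * a).
  transitivity (v ^+ 2 * v ^+ (2 * M - 2) * v ^+ M * f' * a
    + f * (v ^+ (2 * M - 2) * eps)); last by ring.
  rewrite -es.
  have -> : v ^+ 2 * v ^+ (2 * M - 2) * v ^+ M * f' * a = phi ^+ 2 * a.
    by rewrite eW ef; ring.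
  rewrite eF.
  apply/esym/(eq_mod2 chA (c := phi ^+ 2 * a + s ^+ M * phi * (u ^+ M) ^+ 2 * a)); ring.
exists (u ^+ 3 * v * ((u ^+ M) ^+ 6 * d + (u ^+ M) ^+ 5 * b * v * e)
  + u ^+ 3 * v ^+ 3 * (a * s ^+ M * (u ^+ M) ^+ 2 * (v ^+ M) ^+ 4 + a * x ^+ M * (u ^+ M) ^+ 3 * v ^+ M
    + (u ^+ M) ^+ 2 * b * (s ^+ M) ^+ 2 * (v ^+ M) ^+ 4)).
move: (v ^+ (2 * M - 2)) (v ^+ M) (u ^+ M) (s ^+ M) (y ^+ M) (x ^+ M) ed eW ee eF {es ef eW1}.
move=> W V U S Y X ed eW ee eF.
transitivity (u ^+ 3 * v ^+ 3 * (U ^+ 6 * V ^+ 2 * (S ^+ 2 * U ^+ 2 * a + b * f)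
   + U ^+ 5 * b * V ^+ 2 * (V * Y - U * phi)
   + V ^+ 4 * (a * S * U ^+ 2 * V ^+ 4 + a * X * U ^+ 3 * V + U ^+ 2 * b * S ^+ 2 * V ^+ 4))).
  by rewrite eF; ring.
transitivity (u ^+ 3 * v * (v ^+ 2 * W) * V ^+ 2 * (U ^+ 6 * d + U ^+ 5 * b * v * e)
  + u ^+ 3 * v ^+ 3 * V ^+ 4
   * (a * S * U ^+ 2 * V ^+ 4 + a * X * U ^+ 3 * V + U ^+ 2 * b * S ^+ 2 * V ^+ 4)).
  by rewrite ee ed; ring.
by rewrite eW; ring.
Qed.

(** The components of [syz] have degree 2M - 8 in u and v. Giving x and y degree 2, the relation has
    degree 12M - 2, that is 6M - 1 in the grading of x, y, z: one below the balanced degree. The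
    u-divisibility follows from the v-divisibility by [syz_swap]. *)
Lemma syz_divides_uv u v x y : quadratic u v x y -> regular_pair u v ->
  let M := (4 ^ N.+1)%N in
  divides ((u * v) ^+ (4 * M))
    (u ^+ 3 * v ^+ (2 * M + 3) * (syz u v N).1 * x ^+ (4 * M)
     + u ^+ (2 * M + 3) * v ^+ 3 * (syz u v N).2 * y ^+ (4 * M)).
Proof.
move=> q r M; rewrite exprMn; apply: (regular_pair_lcm r); last exact: syz_divides_v.
have := syz_divides_v (quadratic_sym q) (regular_pair_sym r).
by rewrite syz_swap /= -/M addrC (mulrC (v ^+ (2 * M + 3))) (mulrC (v ^+ 3)).
Qed.

(* All exponents in syz are multiples of 8, so the u-exponents of the products in sum8_mem are
   M + 3 modulo 8; this is why those products avoid the monomial u^{M-1} v^{5M-1}. *)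
Inductive sum8 (u v : A) (d : nat) : A -> Prop :=
| Sum8_0 : sum8 u v d 0
| Sum8_D p q : sum8 u v d p -> sum8 u v d q -> sum8 u v d (p + q)
| Sum8_M c k l : (k + l = d)%N -> sum8 u v d (c * u ^+ (8 * k) * v ^+ (8 * l)).

Lemma sum8_mul u v d p c i j :
  sum8 u v d p -> sum8 u v (d + i + j) (c * u ^+ (8 * i) * v ^+ (8 * j) * p).
Proof.
elim=> [|p1 p2 _ h1 _ h2|c' k l <-]; first by rewrite mulr0; apply: Sum8_0.
  by rewrite mulrDr; apply: Sum8_D.
have -> : c * u ^+ (8 * i) * v ^+ (8 * j) * (c' * u ^+ (8 * k) * v ^+ (8 * l))
   = (c * c') * u ^+ (8 * (i + k)) * v ^+ (8 * (j + l)).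
  by rewrite !mulnDr !exprD; ring.
by constructor; lia.
Qed.

Lemma syz_sum8 u v n :
  sum8 u v (4 ^ n - 1) (syz u v n).1 /\ sum8 u v (4 ^ n - 1) (syz u v n).2.
Proof.
elim: n => [|n] /=.
  by have := Sum8_M u v 1 (erefl (0 + 0)%N); rewrite !muln0 !mulr1.
case: (syz u v n) => a b /= [ha hb].
have m0 : (0 < 4 ^ n)%N by rewrite expn_gt0.
have -> : (4 ^ n.+1 - 1 = 4 ^ n - 1 + 3 * 4 ^ n)%N by rewrite expnS; lia.
have -> : (6 * 4 ^ n.+1 = 8 * (3 * 4 ^ n))%N by rewrite expnS; lia.
have hu p c : sum8 u v (4 ^ n - 1) p ->
    sum8 u v (4 ^ n - 1 + 3 * 4 ^ n) (c * u ^+ (8 * (3 * 4 ^ n)) * p).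
  by move=> /(sum8_mul c (3 * 4 ^ n) 0); rewrite addn0 muln0 mulr1.
have hv p c : sum8 u v (4 ^ n - 1) p ->
    sum8 u v (4 ^ n - 1 + 3 * 4 ^ n) (c * v ^+ (8 * (3 * 4 ^ n)) * p).
  by move=> /(sum8_mul c 0 (3 * 4 ^ n)); rewrite addn0 muln0 mulr1.
split; apply: Sum8_D; try exact: hu; try exact: hv.
- by have := hu _ 1 ha; rewrite mul1r.
- by have := hv _ 1 hb; rewrite mul1r.
Qed.

(** Modulo u^8 only the v-terms of the recursion survive, so the second component stays monic in v
    and the first gets the last [g] as leading coefficient, a unit by [lam_g]. *)
Lemma syz_lead u v n : (n <= N)%N ->
  exists kap kap' e e', [/\ kap' * kap = 1,
    (syz u v n).1 = kap * v ^+ (8 * (4 ^ n - 1)) + u ^+ 8 * e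
  & (syz u v n).2 = v ^+ (8 * (4 ^ n - 1)) + u ^+ 8 * e'].
Proof.
elim: n => [_|n IH ltnN].
  by exists 1, 1, 0, 0; rewrite /= !mulr0 !addr0 mulr1.
have [kap [kap' [e [e' [_ ea eb]]]]] := IH (ltnW ltnN).
rewrite /=; case: (syz u v n) ea eb => a b /= ea eb.
have m0 : (0 < 4 ^ n)%N by rewrite expn_gt0.
have eu : u ^+ (6 * 4 ^ n.+1) = u ^+ 8 * u ^+ (24 * 4 ^ n - 8).
  by rewrite -exprD; congr (_ ^+ _); rewrite expnS; lia.
have ev : v ^+ (8 * (4 ^ n.+1 - 1)) = v ^+ (6 * 4 ^ n.+1) * v ^+ (8 * (4 ^ n - 1)).
  by rewrite -exprD; congr (_ ^+ _); rewrite expnS; lia.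
exists (g n), (s' ^+ (4 ^ n.+2) * lam n.+1).
exists (u ^+ (24 * 4 ^ n - 8) * a + g n * v ^+ (6 * 4 ^ n.+1) * e').
exists (v ^+ (6 * 4 ^ n.+1) * e' + g n * u ^+ (24 * 4 ^ n - 8) * a); split.
- by rewrite -mulrA (lam_g ltnN) -exprMn ss' expr1n.
- by rewrite eu ev eb; ring.
- by rewrite eu ev eb; ring.
Qed.

(** All monomials occurring have degree 6M - 2, and in that degree only u^(M-1) v^(5M-1) escapes the
    ideal (u^M, v^(5M)). The congruence of the u-exponents modulo 8 excludes it. *)
Lemma sum8_mem u v d i M p : sum8 u v d p -> (M = 4 * d.+1)%N -> (16 * i <= M)%N ->
  exists e e', u ^+ (M + 3 - 16 * i) * v ^+ (3 * M + 3 + 16 * i) * p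
               = u ^+ M * e + v ^+ (5 * M) * e'.
Proof.
move=> hp eM hi; elim: hp => [|p1 p2 _ [e1 [e1' h1]] _ [e2 [e2' h2]]|c k l kl].
- by exists 0, 0; rewrite !mulr0 addr0.
- by exists (e1 + e2), (e1' + e2'); rewrite mulrDr h1 h2; ring.
- have [le|lt] := leqP (16 * i) (8 * k).
    exists (c * u ^+ (3 + 8 * k - 16 * i) * v ^+ (3 * M + 3 + 16 * i + 8 * l)), 0.
    rewrite mulr0 addr0.
    transitivity (c * u ^+ (M + 3 - 16 * i + 8 * k) * v ^+ (3 * M + 3 + 16 * i + 8 * l)).
      by rewrite !exprD; ring.
    rewrite (_ : M + 3 - 16 * i + 8 * k = M + (3 + 8 * k - 16 * i))%N; last by lia.
    by rewrite !(exprD u M); ring.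
  exists 0, (c * u ^+ (M + 3 - 16 * i + 8 * k) * v ^+ (3 + 16 * i - 8 * k - 8)).
  rewrite mulr0 add0r.
  transitivity (c * u ^+ (M + 3 - 16 * i + 8 * k) * v ^+ (3 * M + 3 + 16 * i + 8 * l)).
    by rewrite !exprD; ring.
  rewrite (_ : 3 * M + 3 + 16 * i + 8 * l = 5 * M + (3 + 16 * i - 8 * k - 8))%N; last by lia.
  by rewrite !(exprD v (5 * M)); ring.
Qed.

(** Iterating [quadratic_pow4], the term with u^(6m) falls into the remainder at each stage, so each
    stage contributes only its s^(2m) v^(8m) term. *)
Lemma pow_y_mod_u u v x y n : quadratic u v x y ->
  exists e, y ^+ (4 ^ n) = \sum_(i < n) s ^+ (2 * 4 ^ i) * u ^+ (4 ^ n - 4 ^ i.+1) * v ^+ (4 ^ n + 4 ^ i.+1)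
            + u ^+ (4 ^ n - 1) * e.
Proof.
move=> q; elim: n => [|n [e IH]].
  by exists y; rewrite big_ord0 mul1r add0r.
rewrite big_ord_recr /= subnn.
have /= := quadratic_pow4 (2 * n) q.
rewrite expnM (_ : 2 ^ 2 = 4)%N // -expnS => ->.
rewrite IH !mulrDl !mulr_suml.
have m0 : (0 < 4 ^ n)%N by rewrite expn_gt0.
set m := (4 ^ n)%N in m0 *; rewrite expnS -/m.
exists (s ^+ m * u ^+ (2 * m + 1) * (v ^+ m) ^+ 2 + e * (v ^+ m) ^+ 3).
have -> : \sum_(i < n) s ^+ (2 * 4 ^ i) * u ^+ (4 * m - 4 ^ i.+1) * v ^+ (4 * m + 4 ^ i.+1)
 = \sum_(i < n) s ^+ (2 * 4 ^ i) * u ^+ (m - 4 ^ i.+1) * v ^+ (m + 4 ^ i.+1) * (u ^+ m) ^+ 3 * (v ^+ m) ^+ 3.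
  apply: eq_bigr => i _.
  have le : (4 ^ i.+1 <= m)%N by rewrite leq_exp2l.
  rewrite -!exprM (_ : 4 * m - 4 ^ i.+1 = m - 4 ^ i.+1 + m * 3)%N; last by lia.
  rewrite (_ : 4 * m + 4 ^ i.+1 = m + 4 ^ i.+1 + m * 3)%N; last by lia.
  by rewrite !(exprD _ (_ + _)%N) !(exprD _ (_ - _)%N) !exprD; ring.
rewrite (_ : 4 * m + 4 * m = m * 8)%N; last by lia.
rewrite (exprMC s 2) (exprM v m 8).
have eu : u ^+ (4 * m - 1) = u ^+ (m - 1) * (u ^+ m) ^+ 3.
  by rewrite -exprM -exprD; congr (_ ^+ _); lia.
have eu6 : u ^+ (4 * m - 1) * u ^+ (2 * m + 1) = (u ^+ m) ^+ 6.
  by rewrite -exprM -exprD; congr (_ ^+ _); lia.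
have -> : u ^+ (4 * m - 1) * (s ^+ m * u ^+ (2 * m + 1) * (v ^+ m) ^+ 2 + e * (v ^+ m) ^+ 3)
  = s ^+ m * (u ^+ (4 * m - 1) * u ^+ (2 * m + 1)) * (v ^+ m) ^+ 2
    + u ^+ (4 * m - 1) * e * (v ^+ m) ^+ 3 by ring.
by rewrite eu6 eu; ring.
Qed.

(** In the expansion of [pow_y_mod_u] the first summand, u^(M-4) v^(M+4), meets the leading term of
    [syz] and gives the monomial u^(M-1) v^(5M-1). The later summands vanish modulo (u^M, v^(5M)) by
    [sum8_mem], and the remainder gains u^3. *)
Lemma pow_y_syz u v x y : quadratic u v x y ->
  let M := (4 ^ N.+1)%N in
  exists kap kap' e e', kap' * kap = 1 /\
    y ^+ M * (u ^+ 3 * v ^+ (2 * M + 3) * (syz u v N).1)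
    = kap * u ^+ (M - 1) * v ^+ (5 * M - 1) + u ^+ M * e + v ^+ (5 * M) * e'.
Proof.
move=> q M.
have [e ey] := pow_y_mod_u N.+1 q; rewrite -/M in ey.
have [kap [kap' [e1 [_ [kk ea _]]]]] := syz_lead u v (leqnn N).
have [h8 _] := syz_sum8 u v N.
have m0 : (0 < 4 ^ N)%N by rewrite expn_gt0.
have eM : M = (4 * 4 ^ N)%N by rewrite /M expnS.
clearbody M.
move: (syz u v N).1 ea h8 => a ea h8.
have [r [r' er]] : exists r r',
    \sum_(i < N) s ^+ (2 * 4 ^ i.+1) * u ^+ (M - 4 ^ i.+2) * v ^+ (M + 4 ^ i.+2)
      * (u ^+ 3 * v ^+ (2 * M + 3) * a) = u ^+ M * r + v ^+ (5 * M) * r'.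
  apply: (big_ind (fun w => exists r r', w = u ^+ M * r + v ^+ (5 * M) * r')).
  - by exists 0, 0; rewrite !mulr0 addr0.
  - by move=> _ _ [r1 [r1' ->]] [r2 [r2' ->]]; exists (r1 + r2), (r1' + r2'); ring.
  - move=> i _.
    have le : (16 * 4 ^ i <= M)%N.
      have : (4 ^ i.+1 <= 4 ^ N)%N by rewrite leq_exp2l.
      by rewrite eM expnS; lia.
    have [|r [r' er]] := sum8_mem h8 _ le; first by rewrite eM; lia.
    exists (s ^+ (2 * 4 ^ i.+1) * r), (s ^+ (2 * 4 ^ i.+1) * r').
    rewrite !(mulrCA _ (s ^+ _)) -mulrDr -er.
    rewrite !expnS !mulnA (_ : 4 * 4 = 16)%N // (_ : M + 3 - 16 * 4 ^ i = (M - 16 * 4 ^ i) + 3)%N; last by lia.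
    rewrite (_ : 3 * M + 3 + 16 * 4 ^ i = (M + 16 * 4 ^ i) + (2 * M + 3))%N; last by lia.
    by rewrite !(exprD _ (_ + 16 * _)) !(exprD _ (_ - _)); ring.
exists (s ^+ 2 * kap), (kap' * s' ^+ 2).
exists (s ^+ 2 * v ^+ (3 * M + 7) * u ^+ 7 * e1 + r + u ^+ 2 * v ^+ (2 * M + 3) * a * e), r'; split.
  rewrite mulrA -(mulrA kap') -exprMn ss' expr1n mulr1 //.
rewrite ey big_ord_recl !mulrDl mulr_suml /= er expn0 muln1 expn1.
have e5 : v ^+ (5 * M - 1) = v ^+ (3 * M + 7) * v ^+ (8 * (4 ^ N - 1)).
  by rewrite -exprD; congr (_ ^+ _); lia.
have e3 : v ^+ (3 * M + 7) = v ^+ (M + 4) * v ^+ (2 * M + 3).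
  by rewrite -exprD; congr (_ ^+ _); lia.
have e4 : u ^+ (M - 1) = u ^+ (M - 4) * u ^+ 3.
  by rewrite -exprD; congr (_ ^+ _); lia.
have eMu : u ^+ M = u ^+ (M - 4) * u ^+ 4.
  by rewrite -exprD; congr (_ ^+ _); lia.
rewrite e5 e3 eMu e4.
transitivity (s ^+ 2 * u ^+ (M - 4) * v ^+ (M + 4) * u ^+ 3 * v ^+ (2 * M + 3)
    * (kap * v ^+ (8 * (4 ^ N - 1)) + u ^+ 8 * e1)
  + (u ^+ (M - 4) * u ^+ 4 * r + v ^+ (5 * M) * r')
  + u ^+ (M - 4) * u ^+ 3 * e * (u ^+ 3 * v ^+ (2 * M + 3) * a)); last by ring.
by rewrite -ea -eMu; ring.
Qed.

(** Split y^(3m) as y^(2m) y^m and apply [pow_y_syz] to y^m. Up to a multiple of u^(3m/2), y^(2m) is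
    s^m v^(4m), and that multiple is absorbed because u^(3m) is already a factor. *)
Lemma syz_lead_monomial u v x y : quadratic u v x y ->
  let m := (4 ^ N.+1)%N in
  exists kap kap' e e', kap' * kap = 1 /\
    u ^+ 3 * v ^+ (2 * m + 3) * (syz u v N).1 * (y ^+ (3 * m) * (u * v) ^+ (3 * m))
    = kap * (u ^+ (4 * m - 1) * v ^+ (12 * m - 1)) + u ^+ (4 * m) * e + v ^+ (12 * m) * e'.
Proof.
move=> Q m.
have [kap [kap' [e1 [e2 [kk eH]]]]] := pow_y_syz Q.
have := quadratic_pow4 (2 * N).+1 Q.
set h := (2 ^ (2 * N).+1)%N => /= ey.
have em : m = (2 * h)%N by rewrite /m /h !expnS expnM mulnA.
have h0 : (0 < h)%N by rewrite expn_gt0.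
rewrite -/m in eH; clearbody m h; subst m.
move: (syz u v N).1 eH => a eH.
exists (kap * s ^+ (2 * h)), (s' ^+ (2 * h) * kap').
exists (v ^+ (3 * (2 * h)) * s ^+ (2 * h) * (v ^+ h) ^+ 8 * e1
  + u ^+ h * v ^+ (3 * (2 * h)) * (s ^+ h * (u ^+ h) ^+ 3 * (v ^+ h) ^+ 2 + y ^+ h * (v ^+ h) ^+ 3)
    * (y ^+ (2 * h) * (u ^+ 3 * v ^+ (2 * (2 * h) + 3) * a))).
exists (u ^+ (3 * (2 * h)) * s ^+ (2 * h) * e2); split.
  by rewrite mulrA -(mulrA _ kap') kk mulr1 -exprMn ss' expr1n.
have -> : y ^+ (3 * (2 * h)) = y ^+ (4 * h) * y ^+ (2 * h).
  by rewrite -exprD; congr (_ ^+ _); lia.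
have e12 : v ^+ (12 * (2 * h)) = v ^+ (3 * (2 * h)) * (v ^+ h) ^+ 8 * v ^+ (5 * (2 * h)).
  by rewrite -exprM -!exprD; congr (_ ^+ _); lia.
have e12' : v ^+ (12 * (2 * h) - 1) = v ^+ (3 * (2 * h)) * (v ^+ h) ^+ 8 * v ^+ (5 * (2 * h) - 1).
  by rewrite -exprM -!exprD; congr (_ ^+ _); lia.
have e4' : u ^+ (4 * (2 * h) - 1) = u ^+ (3 * (2 * h)) * u ^+ (2 * h - 1).
  by rewrite -!exprD; congr (_ ^+ _); lia.
have e4 : u ^+ (4 * (2 * h)) = u ^+ (3 * (2 * h)) * u ^+ (2 * h).
  by rewrite -!exprD; congr (_ ^+ _); lia.
have e6 : u ^+ (2 * h) = (u ^+ h) ^+ 2 by rewrite exprMC.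
rewrite ey exprMn.
transitivity (u ^+ (3 * (2 * h)) * v ^+ (3 * (2 * h)) * ((s ^+ h) ^+ 2 * (v ^+ h) ^+ 8)
   * (y ^+ (2 * h) * (u ^+ 3 * v ^+ (2 * (2 * h) + 3) * a))
  + u ^+ (3 * (2 * h)) * v ^+ (3 * (2 * h)) *
   (s ^+ h * (u ^+ h) ^+ 6 * (v ^+ h) ^+ 2 + y ^+ h * (u ^+ h) ^+ 3 * (v ^+ h) ^+ 3)
   * (y ^+ (2 * h) * (u ^+ 3 * v ^+ (2 * (2 * h) + 3) * a))); first by ring.
rewrite {1}eH e12 e12' e4 e4' e6 (exprMC s); ring.
Qed.

(* Eliminating in turn y^{4M} and x^{4M} between the membership relation and the syzygy
   leaves the same coefficient E, which must then be divisible by u^{2M} v^{4M}. *)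
Lemma elimination_mem u v x y (h P R G al be ga : A) e :
    quadratic u v x y -> regular_pair u v ->
  let M := (2 ^ e)%N in
  h = al * x ^+ (4 * M) + be * y ^+ (4 * M) + ga * (u * v) ^+ (4 * M) ->
  P * x ^+ (4 * M) + R * y ^+ (4 * M) = (u * v) ^+ (4 * M) * G ->
  divides (u ^+ (4 * M)) (R * h) -> divides (v ^+ (4 * M)) (R * h) ->
  exists r r', P * h = u ^+ (4 * M) * r + v ^+ (12 * M) * r'.
Proof.
move=> Q r M eh eS [du edu] [dv edv].
have ey := quadratic_pow4 e Q.
have ex := quadratic_pow4 e (quadratic_sym Q).
rewrite /= -/M in ey ex.
have M0 : (0 < M)%N by rewrite expn_gt0.
have sM : s' ^+ M * s ^+ M = 1 by rewrite -exprMn ss' expr1n.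
have sM2 : (s' ^+ M) ^+ 2 * (s ^+ M) ^+ 2 = 1 by rewrite -exprMn sM expr1n.
set E := R * al + be * P.
have hB : R * h = E * x ^+ (4 * M) + (u * v) ^+ (4 * M) * (be * G + R * ga).
  rewrite eh; apply/esym/(eq_mod2 chA (c := be * P * x ^+ (4 * M))).
  transitivity (E * x ^+ (4 * M) + be * ((u * v) ^+ (4 * M) * G)
    + R * ga * (u * v) ^+ (4 * M)); first by ring.
  by rewrite -eS /E; ring.
have hA : P * h = E * y ^+ (4 * M) + (u * v) ^+ (4 * M) * (al * G + P * ga).
  rewrite eh; apply/esym/(eq_mod2 chA (c := al * R * y ^+ (4 * M))).
  transitivity (E * y ^+ (4 * M) + al * ((u * v) ^+ (4 * M) * G)
    + P * ga * (u * v) ^+ (4 * M)); first by ring.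
  by rewrite -eS /E; ring.
rewrite exprMn in hA hB.
(* Modulo v, x^(4M) is the unit s^(2M) times u^(8M). *)
have Ev : divides (v ^+ (4 * M)) E.
  have eV : v ^+ M = v * v ^+ (M - 1) by rewrite -exprS; congr (_ ^+ _); lia.
  apply: (regular_pair_unit (l := M * 8) (kap := (s ^+ M) ^+ 2)
    (eta := v ^+ (M - 1) * (s ^+ M * (v ^+ M) ^+ 5 * (u ^+ M) ^+ 2
            + x ^+ M * (v ^+ M) ^+ 2 * (u ^+ M) ^+ 3)) r sM2).
  exists (dv - u ^+ (4 * M) * (be * G + R * ga)).
  rewrite mulrBr -edv hB ex exprM.
  have -> : v * (v ^+ (M - 1) * (s ^+ M * (v ^+ M) ^+ 5 * (u ^+ M) ^+ 2
            + x ^+ M * (v ^+ M) ^+ 2 * (u ^+ M) ^+ 3))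
     = v ^+ M * (s ^+ M * (v ^+ M) ^+ 5 * (u ^+ M) ^+ 2
            + x ^+ M * (v ^+ M) ^+ 2 * (u ^+ M) ^+ 3) by rewrite eV; ring.
  by ring.
(* Here x^(4M) is u^(2M) times an element congruent to s^M v^(6M) modulo u, so half of the 4M
   factors of u are lost. *)
have Eu : divides (u ^+ (2 * M)) E.
  have eU : u ^+ M = u * u ^+ (M - 1) by rewrite -exprS; congr (_ ^+ _); lia.
  apply: (regular_pair_unit (l := M * 6) (kap := s ^+ M)
    (eta := u ^+ (M - 1) * ((s ^+ M) ^+ 2 * (u ^+ M) ^+ 5 + x ^+ M * (v ^+ M) ^+ 3))
    (regular_pair_sym r) sM).
  exists (du - v ^+ (4 * M) * (be * G + R * ga)).
  have [ru _ _] := r; apply/eqP; rewrite -subr_eq0; apply/eqP.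
  apply: (regular_exp (k := 2 * M) ru); rewrite mulrBr [in X in _ - X]mulrA -exprD.
  rewrite (_ : 2 * M + 2 * M = 4 * M)%N; last by lia.
  rewrite mulrBr -edu hB ex (exprM v M).
  have -> : u * (u ^+ (M - 1) * ((s ^+ M) ^+ 2 * (u ^+ M) ^+ 5 + x ^+ M * (v ^+ M) ^+ 3))
     = u ^+ M * ((s ^+ M) ^+ 2 * (u ^+ M) ^+ 5 + x ^+ M * (v ^+ M) ^+ 3) by rewrite eU; ring.
  by rewrite !(exprMC u _ M); ring.
have [E' eE] := regular_pair_lcm r Eu Ev.
exists (E' * (v ^+ M) ^+ 4 * (s ^+ M * (u ^+ M) ^+ 4 * (v ^+ M) ^+ 2 + y ^+ M * u ^+ M * (v ^+ M) ^+ 3)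
  + v ^+ (4 * M) * (al * G + P * ga)), ((u ^+ M) ^+ 2 * E' * (s ^+ M) ^+ 2).
by rewrite hA eE ey !(exprMC _ _ M); ring.
Qed.

(** Raise the syzygy to the power q and eliminate: c times the q-th power of [syz_lead_monomial]
    lies in (u^(4M), v^(12M)). The surviving monomial is a unit times u^(4M-q) v^(12M-q), so taking
    the colon ideal by it leaves c in (u^q, v^q). *)
Theorem membership_bound u v x y (c al be ga : A) e :
    quadratic u v x y -> regular_pair u v ->
  let q := (2 ^ e)%N in let M := (4 ^ N.+1 * q)%N in
  c * (y ^+ (3 * M) * (u * v) ^+ (3 * M))
    = al * x ^+ (4 * M) + be * y ^+ (4 * M) + ga * (u * v) ^+ (4 * M) ->
  exists c1 c2, c = u ^+ q * c1 + v ^+ q * c2.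
Proof.
move=> Q r q M ec.
have eqM : M = (2 ^ (2 * N.+1 + e))%N by rewrite expnD expnM.
have [kap [kap' [e1 [e2 [kk eH]]]]] := syz_lead_monomial Q.
have [gam eS] := syz_divides_uv Q r.
have m0 : (0 < 4 ^ N.+1)%N by rewrite expn_gt0.
have q0 : (0 < q)%N by rewrite expn_gt0.
set m := (4 ^ N.+1)%N in m0 eH eS M eqM ec.
move: (syz u v N) eH eS => [a b] /= eH eS.
set SA := u ^+ 3 * v ^+ (2 * m + 3) * a in eH eS.
set SB := u ^+ (2 * m + 3) * v ^+ 3 * b in eS.
have eSq : SA ^+ q * x ^+ (4 * M) + SB ^+ q * y ^+ (4 * M) = (u * v) ^+ (4 * M) * gam ^+ q.
  rewrite /M !(mulnA 4) !(exprM _ (4 * m)) -!exprMn -(exprD_pow2 chA).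
  by rewrite eS.
have frob w1 w2 : (w1 + w2) ^+ q = w1 ^+ q + w2 ^+ q := exprD_pow2 chA w1 w2 e.
have eM : M = (m * q)%N by [].
clearbody q M.
have hu : divides (u ^+ (4 * M)) (SB ^+ q * (c * (y ^+ (3 * M) * (u * v) ^+ (3 * M)))).
  exists (u ^+ (M + 3 * q) * (v ^+ 3 * b) ^+ q * c * y ^+ (3 * M) * v ^+ (3 * M)).
  have -> : SB ^+ q = u ^+ (2 * M + 3 * q) * (v ^+ 3 * b) ^+ q.
    by rewrite /SB -mulrA exprMn -exprM mulnDl -mulnA -eM.
  have e4 : u ^+ (4 * M) * u ^+ (M + 3 * q) = u ^+ (2 * M + 3 * q) * u ^+ (3 * M).
    by rewrite -!exprD; congr (_ ^+ _); lia.
  rewrite (exprMn (3 * M) u v); transitivity (u ^+ (2 * M + 3 * q) * u ^+ (3 * M) *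
    ((v ^+ 3 * b) ^+ q * c * y ^+ (3 * M) * v ^+ (3 * M))); first by ring.
  by rewrite -e4; ring.
have hv : divides (v ^+ (4 * M)) (SB ^+ q * (c * (y ^+ (3 * M) * (u * v) ^+ (3 * M)))).
  exists (SB ^+ q * c * (s * v ^+ 3 + u * x) ^+ M * y ^+ M * u ^+ (3 * M)).
  (* y^2 is divisible by v, which supplies the v^M missing from (uv)^(3M). *)
  have -> : y ^+ (3 * M) = v ^+ M * (s * v ^+ 3 + u * x) ^+ M * y ^+ M.
    rewrite -exprMn (_ : 3 * M = 2 * M + M)%N; last by lia.
    by rewrite exprD exprM; congr (_ ^+ _ * _); case: Q => _ ->; ring.
  rewrite (exprMn (3 * M) u v) (_ : 4 * M = M + 3 * M)%N; last by lia.
  by rewrite (exprD v M); ring.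
rewrite eqM in hu hv eSq ec.
have [t [t' et]] := elimination_mem Q r ec eSq hu hv.
rewrite -eqM in et.
have [c1 [c2 e12]] : exists c1 c2, c * kap ^+ q = u ^+ q * c1 + v ^+ q * c2.
  have ei : (4 * M - q + q = 4 * M)%N by rewrite subnK // eM mulnA leq_pmull // muln_gt0.
  have ej : (12 * M - q + q = 12 * M)%N by rewrite subnK // eM mulnA leq_pmull // muln_gt0.
  apply: (regular_pair_monomial (i := 4 * M - q) (j := 12 * M - q)
    (a := t + c * e1 ^+ q) (b := t' + c * e2 ^+ q) r).
  rewrite ei ej.
  have : c * (SA * (y ^+ (3 * m) * (u * v) ^+ (3 * m))) ^+ q = u ^+ (4 * M) * t + v ^+ (12 * M) * t'.
    rewrite -et [LHS]mulrC !exprMn -!exprM -!(mulnA _ m) -eM; ring.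
  rewrite eH !frob !(exprMn q) -!exprM !mulnBl -!(mulnA _ m) -eM !mul1n => ee.
  apply/esym/(eq_mod2 chA (c := c * (u ^+ (4 * M) * e1 ^+ q + v ^+ (12 * M) * e2 ^+ q))).
  rewrite !mulrDr (addrACA (u ^+ (4 * M) * t)) -ee; ring.
exists (kap' ^+ q * c1), (kap' ^+ q * c2).
rewrite !(mulrCA _ (kap' ^+ q)) -mulrDr -e12 mulrCA -exprMn kk expr1n mulr1 //.
Qed.

End Destabilize.

(** * The free quadratic extension *)

(* The free L-algebra on 1, x, y, xy with x^2 = p + z y and y^2 = q + z x. *)
Section QuadExt.
Variable L : comNzRingType.

Definition qext (p q z : L) : Type := (L * L * (L * L))%type.

Variables p q z : L.
Local Notation C := (qext p q z).

HB.instance Definition _ := GRing.Zmodule.copy C (L * L * (L * L))%type.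

Definition qe (a b c d : L) : C := ((a, b), (c, d)).

Definition qmul (f g : C) : C :=
  let: ((a, b), (c, d)) := f in let: ((a', b'), (c', d')) := g in
  qe (a * a' + p * (b * b') + q * (c * c') + z * q * (b * d' + d * b')
        + z * p * (c * d' + d * c') + p * q * (d * d'))
     (a * b' + b * a' + z * (c * c') + z ^+ 2 * (b * d' + d * b')
        + q * (c * d' + d * c') + p * z * (d * d'))
     (a * c' + c * a' + z * (b * b') + p * (b * d' + d * b')
        + z ^+ 2 * (c * d' + d * c') + q * z * (d * d'))
     (a * d' + d * a' + b * c' + c * b' + z ^+ 2 * (d * d')).

Lemma qmulA : associative qmul.
Proof.
move=> [[a b] [c d]] [[a' b'] [c' d']] [[a2 b2] [c2 d2]]; rewrite /qmul /qe /=.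
congr ((_, _), (_, _)); ring.
Qed.

Lemma qmulC : commutative qmul.
Proof.
move=> [[a b] [c d]] [[a' b'] [c' d']]; rewrite /qmul /qe /=.
congr ((_, _), (_, _)); ring.
Qed.

Lemma qmul1 : left_id (qe 1 0 0 0) qmul.
Proof.
move=> [[a b] [c d]]; rewrite /qmul /qe /=; congr ((_, _), (_, _)); ring.
Qed.

Lemma qmulDl : left_distributive qmul +%R.
Proof.
move=> [[a b] [c d]] [[a' b'] [c' d']] [[a2 b2] [c2 d2]].
rewrite [RHS]/GRing.add /= /qmul /qe /=.
congr ((_, _), (_, _)); rewrite /=; ring.
Qed.

Lemma qone_neq0 : qe 1 0 0 0 != 0.
Proof. by apply/eqP => -[] /eqP; rewrite oner_eq0. Qed.

HB.instance Definition _ :=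
  GRing.Zmodule_isComNzRing.Build C qmulA qmulC qmul1 qmulDl qone_neq0.

Definition qcst (a : L) : C := qe a 0 0 0.
Definition qx : C := qe 0 1 0 0.
Definition qy : C := qe 0 0 1 0.

Lemma qmulE (f g : C) : f * g = qmul f g.
Proof. by []. Qed.

Lemma qcst_is_zmod_morphism : zmod_morphism qcst.
Proof. by move=> a b; rewrite /qcst /qe; congr ((_, _), (_, _)); rewrite ?subr0. Qed.
HB.instance Definition _ := GRing.isZmodMorphism.Build L C qcst qcst_is_zmod_morphism.

Lemma qcst_mulE a (f : C) : qcst a * f = qe (a * f.1.1) (a * f.1.2) (a * f.2.1) (a * f.2.2).
Proof.
case: f => [[b c] [d e]]; rewrite qmulE /qmul /qcst /qe /=.
by congr ((_, _), (_, _)); ring.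
Qed.

Lemma qcst_is_monoid_morphism : monoid_morphism qcst.
Proof.
by split=> // a b; rewrite qcst_mulE /= !mulr0.
Qed.
HB.instance Definition _ := GRing.isMonoidMorphism.Build L C qcst qcst_is_monoid_morphism.

Lemma qx2 : qx ^+ 2 = qcst p + qcst z * qy.
Proof. by rewrite qcst_mulE expr2 qmulE /qmul /=; congr ((_, _), (_, _)); rewrite /=; ring. Qed.

Lemma qy2 : qy ^+ 2 = qcst q + qcst z * qx.
Proof. by rewrite qcst_mulE expr2 qmulE /qmul /=; congr ((_, _), (_, _)); rewrite /=; ring. Qed.

Lemma qext_decomp (f : C) :
  f = qcst f.1.1 + qcst f.1.2 * qx + qcst f.2.1 * qy + qcst f.2.2 * (qx * qy).
Proof.
case: f => [[a b] [c d]]; rewrite !qcst_mulE !qmulE /qmul /qcst /=.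
by congr ((_, _), (_, _)); rewrite /=; ring.
Qed.

Lemma qext_eq0 (f : C) :
  f.1.1 = 0 -> f.1.2 = 0 -> f.2.1 = 0 -> f.2.2 = 0 -> f = 0.
Proof. by case: f => [[a b] [c d]] /= -> -> -> ->. Qed.

Lemma qext_regular_pair (u v : L) : regular_pair u v -> regular_pair (qcst u) (qcst v).
Proof.
move=> [ru rv uv]; split.
- by move=> f; rewrite qcst_mulE => -[*]; apply: qext_eq0; apply: ru.
- by move=> f; rewrite qcst_mulE => -[*]; apply: qext_eq0; apply: rv.
- case=> [[a b] [c d]] [[[a' b'] [c' d']]]; rewrite !qcst_mulE /= => -[ea eb ec ed].
  have [a1 ->] : divides v a by apply: uv; exists a'.
  have [b1 ->] : divides v b by apply: uv; exists b'.
  have [c1 ->] : divides v c by apply: uv; exists c'.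
  have [d1 ->] : divides v d by apply: uv; exists d'.
  by exists (qe a1 b1 c1 d1); rewrite qcst_mulE.
Qed.

Section Lift.
Variables (B : comNzRingType) (phi : {rmorphism L -> B}) (X Y : B).
Hypotheses (hX : X ^+ 2 = phi p + phi z * Y) (hY : Y ^+ 2 = phi q + phi z * X).

Definition qlift (f : C) : B :=
  phi f.1.1 + phi f.1.2 * X + phi f.2.1 * Y + phi f.2.2 * (X * Y).

Lemma qlift_zmod : zmod_morphism qlift.
Proof. by move=> f g; rewrite /qlift !rmorphB /=; ring. Qed.

Lemma qlift_monoid : monoid_morphism qlift.
Proof.
split; first by rewrite /qlift /= rmorph1 !rmorph0 !mul0r !addr0.
move=> [[a b] [c d]] [[a' b'] [c' d']].
rewrite qmulE /qlift /= !(rmorphD, rmorphM, rmorphXn) /=.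
transitivity (phi a * phi a' + (phi a * phi b' + phi b * phi a') * X
  + (phi a * phi c' + phi c * phi a') * Y
  + (phi a * phi d' + phi d * phi a' + phi b * phi c' + phi c * phi b') * (X * Y)
  + phi b * phi b' * (phi p + phi z * Y) + phi c * phi c' * (phi q + phi z * X)
  + (phi b * phi d' + phi d * phi b') * (phi p * Y + phi z * (phi q + phi z * X))
  + (phi c * phi d' + phi d * phi c') * (phi q * X + phi z * (phi p + phi z * Y))
  + phi d * phi d' * ((phi p + phi z * Y) * (phi q + phi z * X))); first by ring.
have eXXY : phi p * Y + phi z * (phi q + phi z * X) = X ^+ 2 * Y.
  by rewrite -hY hX; ring.
have eYYX : phi q * X + phi z * (phi p + phi z * Y) = Y ^+ 2 * X.
  by rewrite -hX hY; ring.
by rewrite eXXY eYYX -hX -hY; ring.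
Qed.

Definition qlift_rmorphism : {rmorphism C -> B} :=
  HB.pack qlift (GRing.isZmodMorphism.Build _ _ _ qlift_zmod)
    (GRing.isMonoidMorphism.Build _ _ _ qlift_monoid).
End Lift.

End QuadExt.

Section MpolyHom.
Variables (n : nat) (R : nzRingType) (B : comNzRingType).

Lemma mpoly_hom_eq (f f' : {rmorphism {mpoly R[n]} -> B}) :
  (forall c, f c%:MP = f' c%:MP) -> (forall i, f 'X_i = f' 'X_i) -> f =1 f'.
Proof.
move=> hc hX; elim/mpolyind => [|c m p _ _ IH]; first by rewrite !rmorph0.
rewrite !rmorphD /= IH -mul_mpolyC !rmorphM /= hc mpolyXE_id !rmorph_prod.
by congr (_ * _ + _); apply: eq_bigr => i _; rewrite !rmorphXn /= hX.
Qed.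
End MpolyHom.

(** * Nonzero polynomials in x, y, z stay nonzero on almost all fibers *)

Section Specialization.
Variable F : fieldType.
Hypothesis chF : 2%N \in [pchar F].

Definition pick3 (T : Type) (a b c : T) (i : 'I_3) : T := nth c [:: a; b] i.

Local Notation H := {mpoly F[3]}.
Local Notation w0 := ('X_(@Ordinal 3 0 isT) : H).
Local Notation w1 := ('X_(@Ordinal 3 1 isT) : H).
Local Notation w2 := ('X_(@Ordinal 3 2 isT) : H).

Lemma pick3P (Q : 'I_3 -> Prop) :
  Q (@Ordinal 3 0 isT) -> Q (@Ordinal 3 1 isT) -> Q (@Ordinal 3 2 isT) -> forall i, Q i.
Proof.
move=> h0 h1 h2 [[|[|[|//]]] hi].
- by rewrite (bool_irrelevance hi isT).
- by rewrite (bool_irrelevance hi isT).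
- by rewrite (bool_irrelevance hi isT).
Qed.

(** Coordinates in the basis 1, x, y, xy of F[x,y,z] over F[X,Y,z]. In the base ring the variables
    [w0], [w1], [w2] stand for X, Y, z; in the source they stand for x, y, z. [free_subst]
    translates back, which gives the left inverse in [free_coord_inj]. *)
Definition free_coord : H -> qext w0 w1 w2 :=
  mmap (@qcst H w0 w1 w2 \o @mpolyC 3 F) (pick3 (qx w0 w1 w2) (qy w0 w1 w2) (qcst w0 w1 w2 w2)).
HB.instance Definition _ := GRing.RMorphism.on free_coord.

Definition free_subst : H -> H :=
  mmap (@mpolyC 3 F) (pick3 (w0 ^+ 2 + w2 * w1) (w1 ^+ 2 + w2 * w0) w2).
HB.instance Definition _ := GRing.RMorphism.on free_subst.

Lemma pchar_mpoly : 2%N \in [pchar H].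
Proof.
by rewrite !inE /= -mpolyC_nat (pcharf0 chF) mpolyC0.
Qed.

Lemma free_subst_x : w0 ^+ 2 = free_subst w0 + free_subst w2 * w1.
Proof.
rewrite /free_subst !mmapX !mmap1U /pick3 /=.
by apply/esym/(eq_mod2 pchar_mpoly (c := w2 * w1)); ring.
Qed.

Lemma free_subst_y : w1 ^+ 2 = free_subst w1 + free_subst w2 * w0.
Proof.
rewrite /free_subst !mmapX !mmap1U /pick3 /=.
by apply/esym/(eq_mod2 pchar_mpoly (c := w2 * w0)); ring.
Qed.

Lemma free_coord_inj : injective free_coord.
Proof.
apply: (can_inj (g := qlift free_subst w0 w1)).
pose f := qlift_rmorphism free_subst_x free_subst_y.
move=> h; rewrite -[LHS]/((f \o free_coord) h) -[RHS]/(idfun h).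
apply: mpoly_hom_eq => [c|]; rewrite /= /free_coord.
  by rewrite mmapC /= /qlift /= /free_subst mmapC !raddf0 !mul0r !addr0.
by apply: pick3P; rewrite mmapX mmap1U /pick3 /= /qlift /= !(rmorph0, rmorph1);
  rewrite /free_subst ?mmapX ?mmap1U /pick3 /=; ring.
Qed.

Local Notation P := {poly {poly F}}.
Definition coordU : P := 'X%:P.
Definition coordV : P := 'X.

Lemma regular_pair_poly : regular_pair coordU coordV.
Proof.
split.
- by move=> w /eqP; rewrite mulf_eq0 polyC_eq0 polyX_eq0 /= => /eqP.
- by move=> w /eqP; rewrite mulf_eq0 polyX_eq0 /= => /eqP.
- move=> w [c ec]; exists (drop_poly 1 w).
  rewrite -{1}(poly_take_drop 1 w) mulrC (_ : take_poly 1 w = 0) ?add0r ?expr1 //.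
  apply/polyP=> i; rewrite coef_take_poly coef0; case: ifP => //.
  rewrite ltnS leqn0 => /eqP ->.
  have := congr1 (fun q : P => q`_0) ec.
  rewrite /coordU /coordV coefCM coefXM /= => /eqP.
  by rewrite mulf_eq0 polyX_eq0 /= => /eqP.
Qed.

Section AtParameter.
Variable s : F.
Let cs : P := s%:P%:P.
Local Notation Cs := (qext (cs * coordU ^+ 4) (cs * coordV ^+ 4) (coordU * coordV)).

Definition specialization : H -> P :=
  mmap (@polyC {poly F} \o @polyC F) (pick3 (cs * coordU ^+ 4) (cs * coordV ^+ 4) (coordU * coordV)).
HB.instance Definition _ := GRing.RMorphism.on specialization.

Definition fiber_xyz : H -> Cs :=
  mmap (@qcst P _ _ _ \o (@polyC {poly F} \o @polyC F))
    (pick3 (qx _ _ _) (qy _ _ _) (qcst _ _ _ (coordU * coordV))).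
HB.instance Definition _ := GRing.RMorphism.on fiber_xyz.

Lemma specialization_vars : [/\ specialization w0 = cs * coordU ^+ 4, specialization w1 = cs * coordV ^+ 4 & specialization w2 = coordU * coordV].
Proof. by split; rewrite /specialization mmapX mmap1U /pick3 /=. Qed.

Lemma fiber_xyzE h : fiber_xyz h =
  qe _ _ _ (specialization (free_coord h).1.1) (specialization (free_coord h).1.2) (specialization (free_coord h).2.1) (specialization (free_coord h).2.2).
Proof.
have sx : qx _ _ _ ^+ 2 = (@qcst P _ _ _ \o specialization) w0 + (@qcst P _ _ _ \o specialization) w2 * qy _ _ _ :> Cs.
  by case: specialization_vars => e0 _ e2; rewrite qx2 /= e0 e2.
have sy : qy _ _ _ ^+ 2 = (@qcst P _ _ _ \o specialization) w1 + (@qcst P _ _ _ \o specialization) w2 * qx _ _ _ :> Cs.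
  by clear sx; case: specialization_vars => _ e1 e2; rewrite qy2 /= e1 e2.
pose f := qlift_rmorphism sx sy.
have -> : fiber_xyz h = f (free_coord h).
  rewrite -[RHS]/((f \o free_coord) h); apply: mpoly_hom_eq => [c|].
    rewrite /= /fiber_xyz /free_coord !mmapC /= /qlift /= /specialization mmapC /=.
    by rewrite !rmorph0 !mul0r !addr0.
  apply: pick3P; rewrite /= /fiber_xyz /free_coord !mmapX !mmap1U /pick3 /= /qlift /=;
   rewrite ?(rmorph0, rmorph1, mul0r, mul1r, add0r, addr0) //.
  by rewrite /specialization mmapX mmap1U.
rewrite /f /= /qlift /= [RHS]qext_decomp /=.
by [].
Qed.

End AtParameter.

Lemma coef_mono (c : F) i' j' i j :
  ((c *: 'X^i')%:P * 'X^j' : P)`_j`_i = c *+ ((i' == i) && (j' == j)).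
Proof.
rewrite coefCM coefXn eq_sym; case: eqP => _; last by rewrite mulr0 coef0 andbF.
by rewrite mulr1 andbT coefZ coefXn eq_sym; case: eqP; rewrite ?mulr1 ?mulr0.
Qed.

(** X^i Y^j z^k goes to s^(i+j) u^(4i+k) v^(4j+k), and these three exponents determine i, j, k.
    Hence the coefficient at a suitable monomial in u, v is a nonzero polynomial in s, which is
    taken as [B]. *)
Lemma specialization_neq0 (a : H) : a != 0 ->
  exists2 B : {poly F}, B != 0 & forall s, B.[s] != 0 -> specialization s a != 0.
Proof.
move=> a0.
have [m0 hm0] : exists m0, a@_m0 != 0.
  have : msupp a != [::] by rewrite msupp_eq0.
  case E : (msupp a) => [//|m0 r] _; exists m0.
  by rewrite -mcoeff_msupp E mem_head.
pose i0 := @Ordinal 3 0 isT; pose i1 := @Ordinal 3 1 isT; pose i2 := @Ordinal 3 2 isT.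
pose ei (m : 'X_{1..3}) := (4 * m i0 + m i2)%N.
pose ej (m : 'X_{1..3}) := (4 * m i1 + m i2)%N.
pose sel m := (ei m == ei m0) && (ej m == ej m0).
pose B : {poly F} := \sum_(m <- msupp a) (a@_m *+ sel m) *: 'X^(m i0 + m i1).
have coefs s : (specialization s a)`_(ej m0)`_(ei m0) = B.[s].
  rewrite /specialization /mmap !coef_sum /B horner_sum; apply: eq_bigr => m _.
  rewrite hornerZ hornerXn.
  rewrite /mmap1 !big_ord_recl big_ord0 /pick3 /= mulr1.
  set l1 := lift _ _; set l2 := lift _ _.
  have -> : l1 = i1 by apply: val_inj.
  have -> : l2 = i2 by apply: val_inj.
  have -> : ord0 = i0 by apply: val_inj.
  rewrite (_ : _ * _ = (((a@_m * s ^+ (m i0 + m i1)) *: 'X^(ei m))%:P * 'X^(ej m))).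
    by rewrite coef_mono -/(sel m) mulrnAl.
  rewrite -mul_polyC !polyCM !polyC_exp -/coordU -/coordV -/(ei m) -/(ej m) /ei /ej.
  move: coordU coordV (s%:P%:P) (a@_m)%:P%:P (m i0) (m i1) (m i2) => U V K A k0 k1 k2.
  by rewrite (exprMn k0 K) (exprMn k1 K) (exprMn k2 U) -!exprM !exprD; ring.
exists B; last by move=> s; apply: contra => /eqP h; rewrite -coefs h !coef0.
apply/eqP => /(congr1 (fun q : {poly F} => q`_(m0 i0 + m0 i1))).
rewrite coef0 coef_sum (bigD1_seq m0) ?msupp_uniq ?mcoeff_msupp //=.
rewrite big1 => [|m hm].
  by rewrite addr0 coefZ coefXn eqxx mulr1 /sel !eqxx => /eqP; apply/negP.
rewrite coefZ coefXn; case: eqP => [e|_]; last by rewrite mulr0.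
rewrite /sel; case: andP => [[/eqP e1 /eqP e2]|_]; last by rewrite mul0r.
case/eqP: hm; apply/mnmP; rewrite /ei /ej in e1 e2.
by apply: pick3P; rewrite -?/i0 -?/i1 -?/i2; lia.
Qed.

Lemma fiber_xyz_neq0 (h : H) : h != 0 ->
  exists2 B : {poly F}, B != 0 & forall s, B.[s] != 0 -> fiber_xyz s h != 0.
Proof.
move=> h0.
have g0 : free_coord h != 0 by rewrite -(rmorph0 free_coord) (inj_eq free_coord_inj).
have [a [a0 ha]] : exists a, a != 0 /\ forall s, fiber_xyz s h = 0 -> specialization s a = 0.
  have [e1|] := eqVneq (free_coord h).1.1 0; last first.
    by move=> n; eexists; split; [exact: n|] => s; rewrite fiber_xyzE => -[].
  have [e2|] := eqVneq (free_coord h).1.2 0; last first.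
    by move=> n; eexists; split; [exact: n|] => s; rewrite fiber_xyzE => -[].
  have [e3|] := eqVneq (free_coord h).2.1 0; last first.
    by move=> n; eexists; split; [exact: n|] => s; rewrite fiber_xyzE => -[].
  have [e4|] := eqVneq (free_coord h).2.2 0; last first.
    by move=> n; eexists; split; [exact: n|] => s; rewrite fiber_xyzE => -[].
  by move: g0; rewrite (qext_eq0 e1 e2 e3 e4) eqxx.
have [B B0 hB] := specialization_neq0 a0; exists B => // s /hB.
by apply: contra => /eqP /ha ->.
Qed.

End Specialization.

(** * Parameters with a syzygy of small degree *)

Section Destabilizing.
Variable F : closedFieldType.
Hypothesis chF : 2%N \in [pchar F].

(* The fraction iter_frac n is the n-th iterate, starting at 1, of nu |-> (nu + s^2 / nu)^4. *)
Fixpoint iter_frac (n : nat) : {poly F} * {poly F} :=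
  if n is n'.+1 then
    let: (a, b) := iter_frac n' in ((a ^+ 2 + 'X^2 * b ^+ 2) ^+ 4, (a * b) ^+ 4)
  else (1, 1).

(** A degree gap of at least two keeps the numerator dominant over X times the denominator, so the
    equation nu = s is nonconstant. The index starts at 1 because the initial fraction 1/1 has no
    gap. *)
Lemma size_iter_frac n :
  [/\ (0 < size (iter_frac n.+1).2)%N & ((size (iter_frac n.+1).2).+1 < size (iter_frac n.+1).1)%N].
Proof.
have s1 : size (1 + 'X^2 : {poly F}) = 3%N.
  by rewrite addrC size_polyDl ?size_polyXn // size_poly1.
elim: n => [|n].
  rewrite /= !expr1n mulr1 mulr1 expr1n size_poly1.
  have := size_exp (1 + 'X^2 : {poly F}) 4.
  by rewrite s1 => h; split=> //; move: h; case: size => //= k ->.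
have -> : iter_frac n.+2 = (((iter_frac n.+1).1 ^+ 2 + 'X^2 * (iter_frac n.+1).2 ^+ 2) ^+ 4,
    ((iter_frac n.+1).1 * (iter_frac n.+1).2) ^+ 4) by rewrite /=; case: (iter_frac n).
move: (iter_frac n.+1).1 (iter_frac n.+1).2 => a b /= [b0 hab].
have b0' : b != 0 by rewrite -size_poly_gt0.
have a0 : a != 0 by rewrite -size_poly_gt0; apply: leq_trans hab.
have sX : size ('X^2 * b ^+ 2) = (2 * size b + 1)%N.
  rewrite mulrC size_mulXn ?expf_neq0 //; have := size_exp b 2.
  have : (0 < size (b ^+ 2))%N by rewrite size_poly_gt0 expf_neq0.
  by move: b0; move: (size (b ^+ 2)) (size b) => [|i] [|j] //= _ _ ->; lia.
have sA : size (a ^+ 2) = (2 * size a - 1)%N.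
  have : (0 < size (a ^+ 2))%N by rewrite size_poly_gt0 expf_neq0.
  have := size_exp a 2; have := leq_trans (ltn0Sn _) hab.
  by move: (size (a ^+ 2)) (size a) => [|i] [|j] //= _ -> _; lia.
have sS : size (a ^+ 2 + 'X^2 * b ^+ 2) = (2 * size a - 1)%N.
  rewrite size_polyDl ?sA ?sX //.
  by move: hab; clear; move: (size a) (size b) => k l; lia.
have c0 : a ^+ 2 + 'X^2 * b ^+ 2 != 0 by rewrite -size_poly_gt0 sS; move: hab; clear; move: (size a) (size b) => k l; lia.
have := size_exp (a ^+ 2 + 'X^2 * b ^+ 2) 4; have := size_exp (a * b) 4.
have : (0 < size ((a ^+ 2 + 'X^2 * b ^+ 2) ^+ 4))%N by rewrite size_poly_gt0 expf_neq0.
have : (0 < size ((a * b) ^+ 4))%N by rewrite size_poly_gt0 !(expf_neq0, mulf_neq0).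
rewrite sS (size_mul a0 b0').
move: (size ((a * b) ^+ 4)) (size ((a ^+ 2 + _) ^+ 4)) (size a) (size b) b0 hab; clear.
by move=> i j k l *; split; lia.
Qed.

Lemma iter_frac_step n s :
  (iter_frac n.+1).1.[s] = ((iter_frac n).1.[s] ^+ 2 + s ^+ 2 * (iter_frac n).2.[s] ^+ 2) ^+ 4 /\
  (iter_frac n.+1).2.[s] = ((iter_frac n).1.[s] * (iter_frac n).2.[s]) ^+ 4.
Proof.
rewrite /=; case: (iter_frac n) => a b /=.
by rewrite !(horner_exp, hornerD, hornerM, hornerX).
Qed.

Definition destabilizing n s : Prop := (iter_frac n.+1).1.[s] = s * (iter_frac n.+1).2.[s].

Lemma destabilizing_exists n : exists s, destabilizing n s.
Proof.
have [h1 h2] := size_iter_frac n.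
have sX : size ('X * (iter_frac n.+1).2) = (size (iter_frac n.+1).2).+1.
  by rewrite mulrC size_mulX // -size_poly_gt0.
have : size ((iter_frac n.+1).1 + 'X * (iter_frac n.+1).2) != 1%N.
  rewrite size_polyDl ?sX //; apply/eqP => e; move: h2; rewrite e; lia.
move=> /closed_rootP [s /rootP]; rewrite hornerD hornerM hornerX => e; exists s.
by apply/eqP; rewrite -subr_eq0 (oppr_pchar2 chF) e.
Qed.

Lemma iter_frac_neq0 n s : s != 0 -> ((iter_frac n).1.[s] != 0) || ((iter_frac n).2.[s] != 0).
Proof.
move=> s0; elim: n => [|n IH]; first by rewrite /= hornerC oner_neq0.
have [-> ->] := iter_frac_step n s; rewrite !expf_eq0 /= mulf_eq0.
have [a0|a0] := eqVneq (iter_frac n).1.[s] 0.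
  move: IH; rewrite a0 eqxx /= => b0.
  by rewrite expr0n add0r mulf_neq0 // expf_neq0.
have [b0|//] := eqVneq (iter_frac n).2.[s] 0.
  by rewrite b0 expr0n mulr0 addr0 expf_neq0.
by rewrite orbT.
Qed.

(** At s = 0 every numerator is nonzero, which contradicts nu = 0. Each denominator is the fourth
    power of the previous numerator times denominator, so nonvanishing propagates down from the top
    level. *)
Lemma destabilizing_neq0 n s : destabilizing n s ->
  s != 0 /\ forall k, (k <= n.+1)%N -> (iter_frac k).1.[s] != 0 /\ (iter_frac k).2.[s] != 0.
Proof.
move=> gs.
have s0 : s != 0.
  apply/eqP => e; move: gs; rewrite /destabilizing e mul0r => /eqP; apply/negP.
  elim: (n.+1) => [|k IH]; first by rewrite /= hornerC oner_neq0.
  by have [-> _] := iter_frac_step k 0; rewrite expr0n mul0r addr0 !expf_neq0.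
split=> //.
have hb : (iter_frac n.+1).2.[s] != 0.
  have := iter_frac_neq0 n.+1 s0; rewrite gs mulf_eq0 (negbTE s0) /=.
  by case: eqP.
have ha : (iter_frac n.+1).1.[s] != 0 by rewrite gs mulf_neq0.
move=> k /subnK; move: (n.+1 - k)%N => j; elim: j k => [|j IH] k e.
  by rewrite add0n in e; rewrite e.
have [|_] := IH k.+1; first by rewrite addnS -addSn.
have [_ ->] := iter_frac_step k s; rewrite expf_eq0 /= mulf_eq0 negb_or.
by case/andP.
Qed.

(** If nu_(i+1) = s, the next iterate is (s + s^2 / s)^4 = 0 in characteristic 2, whereas all
    numerators up to level j + 1 are nonzero. *)
Lemma destabilizing_disjoint i j s : destabilizing i s -> destabilizing j s -> (i < j)%N -> False.
Proof.
move=> gi gj ij; have [s0 h] := destabilizing_neq0 gj.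
have [+ _] := h i.+2 ij.
have [-> _] := iter_frac_step i.+1 s; rewrite gi exprMn -mulr2n.
by rewrite (mulrn_pchar chF) expr0n eqxx.
Qed.

Lemma destabilizing_avoid (G : {poly F}) : G != 0 -> exists n s, destabilizing n s /\ G.[s] != 0.
Proof.
move=> G0; apply: contrapT => noG.
pose f n := projT1 (cid (destabilizing_exists n)).
have hf n : destabilizing n (f n) := projT2 (cid (destabilizing_exists n)).
have rootG n : root G (f n).
  by apply/rootP/eqP/negPn/negP => h; apply: noG; exists n, (f n).
have injf : injective f.
  move=> i j e; have [ij|ji|//] := ltngtP i j.
    by case: (destabilizing_disjoint (hf i) _ ij); rewrite e.
  by case: (destabilizing_disjoint (hf j) _ ji); rewrite -e.
have := max_poly_roots (rs := [seq f i | i <- iota 0 (size G)]) G0.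
rewrite size_map size_iota ltnn (map_inj_uniq injf) iota_uniq.
by case/(_ _ isT)/negP => //; apply/allP => _ /mapP [i _ ->].
Qed.

(** [lam] is the sequence of iterates read backwards, with the k-th term raised to the power
    4^(k+1): additivity of Frobenius then turns one iteration into one recursion step. The ends come
    from nu_0 = 1 and nu_(n+1) = s. *)
Lemma destabilizing_chain n s : destabilizing n s -> exists g lam : nat -> F,
  [/\ lam 0%N = s ^+ 4, lam n.+1 = 1,
      forall k, (k < n.+1)%N -> lam k.+1 * g k = s ^+ (4 ^ k.+2)
    & forall k, (k < n.+1)%N -> lam k = lam k.+1 + g k * s ^+ (4 ^ k.+2)].
Proof.
move=> gs; have [s0 nz] := destabilizing_neq0 gs.
pose nu k := (iter_frac k).1.[s] / (iter_frac k).2.[s].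
have nu0 k : (k <= n.+1)%N -> nu k != 0.
  by move=> /nz [a0 b0]; rewrite mulf_neq0 ?invr_neq0.
have nuS k : (k <= n)%N -> nu k.+1 = (nu k + s ^+ 2 / nu k) ^+ 4.
  move=> kn; rewrite /nu; have [-> ->] := iter_frac_step k s; rewrite -expr_div_n.
  have [|a0 b0] := nz k; first exact: leqW.
  by congr (_ ^+ 4); field; rewrite a0 b0.
pose lam k := nu (n.+1 - k)%N ^+ (4 ^ k.+1).
exists (fun k => s ^+ (4 ^ k.+2) / lam k.+1), lam; split.
- rewrite /lam subn0 /nu gs mulfK //.
  by have [] := nz n.+1 (leqnn _).
- by rewrite /lam subnn /nu /= hornerC divr1 expr1n.
- move=> k kn; rewrite mulrC divfK // /lam expf_neq0 // nu0 //.
  by rewrite leq_subr.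
- move=> k kn; rewrite /lam subSS -(subnSK kn) /= subSS nuS ?leq_subr //.
  rewrite -exprM -expnS (exprD_pow4 chF); congr (_ + _).
  by rewrite (exprMn _ (s ^+ 2)) exprVn exprAC expr2; ring.
Qed.

End Destabilizing.

Lemma mpoly_gen_ind (n : nat) (R : nzRingType) (Q : {mpoly R[n]} -> Prop) :
  (forall c, Q c%:MP) -> (forall i, Q 'X_i) ->
  (forall p q, Q p -> Q q -> Q (p + q)) -> (forall p q, Q p -> Q q -> Q (p * q)) ->
  forall p, Q p.
Proof.
move=> hC hX hD hM; elim/mpolyind => [|c m p _ _ IH]; first by rewrite -mpolyC0.
apply: (hD) => //; rewrite -mul_mpolyC; apply: (hM) => //.
rewrite mpolyXE_id; apply: big_ind => [|p1 p2|i _]; [by rewrite -mpolyC1 | exact: hM |].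
elim: (m i) => [|k IHk]; first by rewrite expr0 -mpolyC1.
by rewrite exprS; apply: hM.
Qed.

(** * The hypersurface ring *)

Section Hypersurface.
Variable F : fieldType.
Local Notation R := (hypR F).
Local Notation M4 := {mpoly F[4]}.

HB.instance Definition _ := GRing.RMorphism.copy (@toR F) \pi_({ideal_quot (@rel_ideal F)}).

Lemma toRP (p q : M4) : reflect (exists w, p - q = w * rel_pol F) (toR p == toR q).
Proof. by rewrite /toR -Quotient.idealrBE; apply: asboolP. Qed.

Lemma toR_surj (r : R) : exists p, r = toR p.
Proof. by exists (repr r); rewrite /toR reprK. Qed.

Definition Rt : R := toR (polT F).

Lemma hyp_relation : Rt * Rz ^+ 4 + (Rx ^+ 2 + Ry * Rz) * (Ry ^+ 2 + Rx * Rz) = 0 :> R.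
Proof.
rewrite /Rt /Rx /Ry /Rz -!(rmorphXn, rmorphM, rmorphD) /= -(rmorph0 (@toR F)).
by apply/eqP/toRP; exists 1; rewrite subr0 mul1r.
Qed.

Lemma pick4P (Q : 'I_4 -> Prop) :
  Q (@Ordinal 4 0 isT) -> Q (@Ordinal 4 1 isT) -> Q (@Ordinal 4 2 isT) ->
  Q (@Ordinal 4 3 isT) -> forall i, Q i.
Proof.
move=> h0 h1 h2 h3 [[|[|[|[|//]]]] hi];
  by rewrite (bool_irrelevance hi isT).
Qed.

Definition pick4 (T : Type) (a b c d : T) (i : 'I_4) : T := nth d [:: a; b; c] i.

Definition kill_z : M4 -> M4 :=
  mmap (@mpolyC 4 F) (pick4 (polX F) (polY F) 0 (polT F)).
HB.instance Definition _ := GRing.RMorphism.on kill_z.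

Lemma kill_z_vars : [/\ kill_z (polX F) = polX F, kill_z (polY F) = polY F,
  kill_z (polZ F) = 0 & kill_z (polT F) = polT F].
Proof. by split; rewrite /kill_z mmapX mmap1U /pick4 /=. Qed.

Lemma kill_z_mod p : exists w, p = kill_z p + polZ F * w.
Proof.
case: kill_z_vars => hx hy hz ht.
elim/mpoly_gen_ind: p => [c||p q [w1 e1] [w2 e2]|p q [w1 e1] [w2 e2]].
- by exists 0; rewrite /kill_z mmapC mulr0 addr0.
- apply: pick4P.
  + by exists 0; rewrite [X in kill_z X]/(polX F) hx mulr0 addr0.
  + by exists 0; rewrite -/(polY F) hy mulr0 addr0.
  + by exists 1; rewrite -/(polZ F) hz mulr1 add0r.
  + by exists 0; rewrite -/(polT F) ht mulr0 addr0.
- by exists (w1 + w2); rewrite {1}e1 {1}e2 rmorphD /=; ring.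
- exists (kill_z p * w2 + w1 * kill_z q + polZ F * w1 * w2).
  by rewrite {1}e1 {1}e2 rmorphM /=; ring.
Qed.

(** At z = 0 the defining polynomial becomes x^2 y^2, which is nonzero, so a multiple of it
    divisible by z has its cofactor divisible by z. *)
Lemma Rz_regular (r : R) : Rz * r = 0 -> r = 0.
Proof.
case: (toR_surj r) => p -> {r}; rewrite /Rz -rmorphM -(rmorph0 (@toR F)).
move/eqP/toRP => [b]; rewrite subr0 => e.
have [w ew] := kill_z_mod b.
have [hx hy hz ht] := kill_z_vars.
have nzX i : 'X_i != 0 :> M4.
  by apply/eqP => /(congr1 (mcoeff U_(i))); rewrite mcoeffXU eqxx mcoeff0 => /eqP; rewrite oner_eq0.
have kb : kill_z b = 0.
  have := congr1 kill_z e; rewrite !rmorphM /= hz mul0r /rel_pol.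
  rewrite !(rmorphD, rmorphM, rmorphXn) /= hx hy hz ht.
  rewrite expr0n /= !mulr0 add0r !addr0 => /esym/eqP.
  have nz : polX F ^+ 2 * polY F ^+ 2 != 0 by rewrite mulf_neq0 // expf_neq0 // nzX.
  by rewrite mulf_eq0 (negbTE nz) orbF => /eqP.
apply/eqP/toRP; exists w; rewrite subr0.
apply: (mulfI (nzX (@Ordinal 4 2 isT))).
by rewrite -/(polZ F) e {1}ew kb add0r mulrA.
Qed.

Lemma Rz_exp_regular k (r : R) : Rz ^+ k * r = 0 -> r = 0.
Proof. exact: (regular_exp Rz_regular). Qed.

Definition iota3 : {mpoly F[3]} -> R :=
  mmap (@toR F \o @mpolyC 4 F) (pick3 Rx Ry Rz).
HB.instance Definition _ := GRing.RMorphism.on iota3.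

Lemma iota3_vars : [/\ iota3 'X_(@Ordinal 3 0 isT) = Rx, iota3 'X_(@Ordinal 3 1 isT) = Ry
  & iota3 'X_(@Ordinal 3 2 isT) = Rz].
Proof. by split; rewrite /iota3 mmapX mmap1U /pick3 /=. Qed.

(* Away from z the ring is F[x,y,z,1/z], because t = - (x^2+yz)(y^2+xz) / z^4. *)
Lemma clear_z (r : R) : exists k h, Rz ^+ k * r = iota3 h.
Proof.
have [hx hy hz] := iota3_vars.
case: (toR_surj r) => p -> {r}.
elim/mpoly_gen_ind: p => [c||p q [k1 [h1 e1]] [k2 [h2 e2]]|p q [k1 [h1 e1]] [k2 [h2 e2]]].
- by exists 0%N, c%:MP; rewrite mul1r /iota3 mmapC.
- apply: pick4P.
  + by exists 0%N; eexists; rewrite mul1r; exact: esym hx.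
  + by exists 0%N; eexists; rewrite mul1r; exact: esym hy.
  + by exists 0%N; eexists; rewrite mul1r; exact: esym hz.
  + exists 4%N.
    set x := 'X_(@Ordinal 3 0 isT) : {mpoly F[3]}.
    set y := 'X_(@Ordinal 3 1 isT) : {mpoly F[3]}.
    set z := 'X_(@Ordinal 3 2 isT) : {mpoly F[3]}.
    exists (- ((x ^+ 2 + y * z) * (y ^+ 2 + x * z))).
    rewrite rmorphN rmorphM !rmorphD !rmorphXn !rmorphM /= hx hy hz.
    by apply/eqP; rewrite -subr_eq0 opprK mulrC; apply/eqP/hyp_relation.
- exists (k1 + k2)%N, ('X_(@Ordinal 3 2 isT) ^+ k2 * h1 + 'X_(@Ordinal 3 2 isT) ^+ k1 * h2).
  by rewrite rmorphD rmorphD !rmorphM !rmorphXn /= hz -e1 -e2 exprD; ring.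
- exists (k1 + k2)%N, (h1 * h2).
  by rewrite rmorphM rmorphM /= -e1 -e2 exprD; ring.
Qed.

(** Replaces a multiplier in R by a nonzero polynomial in x, y, z, for which [fiber_xyz_neq0] is
    available. *)
Lemma clear_z_neq0 (r : R) : r != 0 -> exists d h, h != 0 /\ d * r = iota3 h.
Proof.
move=> r0; have [k [h e]] := clear_z r; exists (Rz ^+ k), h; split=> //.
by apply: contraNneq r0 => h0; move: e; rewrite h0 rmorph0 => /Rz_exp_regular ->.
Qed.

End Hypersurface.

(** * Ideals and localization *)

Section IdealGen.
Variable A : comPzRingType.

Lemma ideal_gen_ind (X : set A) (Q : A -> Prop) :
  Q 0 -> (forall a b, Q a -> Q b -> Q (a + b)) -> (forall c a, X a -> Q (c * a)) ->
  forall a, ideal_gen X a -> Q a.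
Proof.
move=> Q0 QD QX _ [n [c [g [hg ->]]]].
by apply: big_ind => // i _; apply: QX.
Qed.

Lemma ideal_gen_mem (X : set A) c a : X a -> ideal_gen X (c * a).
Proof.
move=> Xa; exists 1%N, (fun=> c), (fun=> a); split=> //.
by rewrite big_ord_recl big_ord0 addr0.
Qed.

Lemma ideal_genD (X : set A) a b : ideal_gen X a -> ideal_gen X b -> ideal_gen X (a + b).
Proof.
move=> [n [c [g [hg ->]]]] [m [d [k [hk ->]]]].
exists (n + m)%N.
exists (fun i => match split i with inl j => c j | inr j => d j end).
exists (fun i => match split i with inl j => g j | inr j => k j end).
split; first by move=> i; case: split => j.
rewrite big_split_ord /=; congr (_ + _); apply: eq_bigr => i _.
  by rewrite (unsplitK (inl i)).
by rewrite (unsplitK (inr i)).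
Qed.

End IdealGen.

Section Ideals.
Variable A : comNzRingType.

Definition in_ideal3 (x y z r : A) : Prop := exists a b c, r = a * x + b * y + c * z.

Lemma in_ideal3_0 x y z : in_ideal3 x y z 0.
Proof. by exists 0, 0, 0; rewrite !mul0r !addr0. Qed.

Lemma in_ideal3D x y z a b : in_ideal3 x y z a -> in_ideal3 x y z b -> in_ideal3 x y z (a + b).
Proof.
move=> [a1 [a2 [a3 ->]]] [b1 [b2 [b3 ->]]]; exists (a1 + b1), (a2 + b2), (a3 + b3); ring.
Qed.

Lemma in_ideal3M x y z c a : in_ideal3 x y z a -> in_ideal3 x y z (c * a).
Proof. by move=> [a1 [a2 [a3 ->]]]; exists (c * a1), (c * a2), (c * a3); ring. Qed.

Hypothesis chA : 2%N \in [pchar A].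

Lemma bracket_power3 x y z e r :
  bracket_power (2 ^ e) (ideal_gen [set x ^+ 4; y ^+ 4; z ^+ 4]%classic) r ->
  in_ideal3 (x ^+ (4 * 2 ^ e)) (y ^+ (4 * 2 ^ e)) (z ^+ (4 * 2 ^ e)) r.
Proof.
move: r; apply: ideal_gen_ind; [exact: in_ideal3_0 | by move=> *; apply: in_ideal3D |].
move=> c _ [w hw <-]; apply: in_ideal3M; move: w hw; apply: ideal_gen_ind.
- by rewrite expr0n expn_eq0; apply: in_ideal3_0.
- by move=> a b ha hb; rewrite exprD_pow2 //; apply: in_ideal3D.
- move=> d a ha; rewrite exprMn; apply: in_ideal3M; rewrite !exprM.
  case: ha => [[]|] ->.
  + by exists 1, 0, 0; rewrite !mul0r !addr0 mul1r.
  + by exists 0, 1, 0; rewrite !mul0r addr0 add0r mul1r.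
  + by exists 0, 0, 1; rewrite !mul0r !add0r mul1r.
Qed.

End Ideals.

Section Localize.
Variables (A : comNzRingType) (S : mulrClosed A).

Lemma loc_of_eq0 (a : A) : loc_of S a = 0 -> exists2 w, w \in S & w * a = 0.
Proof.
rewrite -(rmorph0 (loc_of S)) => /eqP; rewrite !piE => /loc_equivP [w wS].
by rewrite /= mul0r subr0 mulr1; exists w.
Qed.

Lemma loc_of_inv (w : A) : w \in S -> exists w', w' * loc_of S w = 1.
Proof.
move=> wS; exists (\pi_(loc S) (mkpreloc 1 wS)).
rewrite -[LHS]/(loc_mul _ _) -[RHS]/(loc_of S 1) !piE.
by apply: loc_eq_cross; rewrite /= !mul1r !mulr1.
Qed.

Lemma loc_denominator (c : loc S) : exists2 w, w \in S & exists a, loc_of S w * c = loc_of S a.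
Proof.
elim/quotW: c => -[[a w] wS]; exists w => //; exists a.
rewrite -[LHS]/(loc_mul _ _) !piE.
by apply: loc_eq_cross => /=; ring.
Qed.

Lemma loc_common_denominator n (c : 'I_n -> loc S) :
  exists2 w, w \in S & exists a : 'I_n -> A, forall i, loc_of S w * c i = loc_of S (a i).
Proof.
elim: n c => [|n IH] c; first by exists 1; rewrite ?rpred1 //; exists (fun=> 0); case.
have [w wS [a ha]] := IH (fun i => c (lift ord0 i)).
have [w0 w0S [a0 ha0]] := loc_denominator (c ord0).
exists (w * w0); first exact: rpredM.
exists (fun i => if unlift ord0 i is Some j then w0 * a j else w * a0) => i.
case: unliftP => [j|] ->.
  by rewrite !rmorphM /= -ha mulrCA mulrA.
by rewrite !rmorphM /= -ha0 mulrA.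
Qed.

Lemma loc_idealP (J : set A) (r : A) : loc_ideal S J (loc_of S r) ->
  exists2 w, w \in S & ideal_gen J (w * r).
Proof.
case=> n [c [g [hg er]]].
have [w wS [a ha]] := loc_common_denominator c.
have hg' i : exists2 k, J k & loc_of S k = g i by have [k Jk <-] := hg i; exists k.
pose k i := projT1 (cid2 (hg' i)).
have hk i : J (k i) /\ loc_of S (k i) = g i.
  by rewrite /k; case: cid2.
have : loc_of S (w * r - \sum_(i < n) a i * k i) = 0.
  rewrite rmorphB rmorphM /= er mulr_sumr rmorph_sum /= -sumrB big1 // => i _.
  by rewrite rmorphM /= (hk i).2 -ha mulrA subrr.
case/loc_of_eq0 => v vS; rewrite mulrBr mulrA mulr_sumr => e.
exists (v * w); first exact: rpredM.
exists n, (fun i => v * a i), k; split; first by move=> i; case: (hk i).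
by rewrite (subr0_eq e); apply: eq_bigr => i _; rewrite mulrA.
Qed.

End Localize.

Lemma quadratic_relation (A : comNzRingType) (chA : 2%N \in [pchar A]) (t p q x y z : A) :
  x ^+ 2 = p + z * y -> y ^+ 2 = q + z * x ->
  t * z ^+ 4 + (x ^+ 2 + y * z) * (y ^+ 2 + x * z) = t * z ^+ 4 + p * q.
Proof.
move=> -> ->; rewrite (mulrC y) (mulrC x) -!addrA.
by rewrite !(addrr_pchar2 chA) !addr0.
Qed.

(** * Fibers of the family *)

Section Fiber.
Variable F : fieldType.
Hypothesis chF : 2%N \in [pchar F].
Local Notation R := (hypR F).
Local Notation M4 := {mpoly F[4]}.
Local Notation P := {poly {poly F}}.
Local Notation pu := (coordU F).
Local Notation pv := (coordV F).

Lemma pchar_hypR : 2%N \in [pchar R].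
Proof.
rewrite !inE /= -(rmorph_nat (@toR F \o @mpolyC 4 F)).
by rewrite (pcharf0 chF) rmorph0.
Qed.

Variable s : F.
Local Notation cs := (s%:P%:P : P).
Local Notation Cs := (qext (cs * pu ^+ 4) (cs * pv ^+ 4) (pu * pv)).
Local Notation cC := (@qcst P (cs * pu ^+ 4) (cs * pv ^+ 4) (pu * pv)).
Local Notation qX := (qx (cs * pu ^+ 4) (cs * pv ^+ 4) (pu * pv)).
Local Notation qY := (qy (cs * pu ^+ 4) (cs * pv ^+ 4) (pu * pv)).

Lemma pchar_qext : 2%N \in [pchar Cs].
Proof.
rewrite !inE /= -(rmorph_nat (cC \o (@polyC {poly F} \o @polyC F))).
by rewrite (pcharf0 chF) rmorph0.
Qed.

Definition fiber_poly : M4 -> Cs :=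
  mmap (cC \o (@polyC {poly F} \o @polyC F)) (pick4 qX qY (cC (pu * pv)) (cC (cs ^+ 2))).
HB.instance Definition _ := GRing.RMorphism.on fiber_poly.

Lemma fiber_poly_vars : [/\ fiber_poly (polX F) = qX, fiber_poly (polY F) = qY,
  fiber_poly (polZ F) = cC (pu * pv) & fiber_poly (polT F) = cC (cs ^+ 2)].
Proof. by split; rewrite /fiber_poly mmapX mmap1U /pick4 /=. Qed.

Lemma fiber_poly_rel : fiber_poly (rel_pol F) = 0.
Proof.
have [hx hy hz ht] := fiber_poly_vars.
rewrite /rel_pol rmorphD (rmorphM _ (polT F)) (rmorphM _ (_ + _)) !rmorphD.
rewrite (rmorphM _ (polY F)) (rmorphM _ (polX F)) !rmorphXn /= hx hy hz ht.
rewrite (quadratic_relation pchar_qext _ (qx2 _ _ _) (qy2 _ _ _)).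
rewrite -!rmorphXn -!rmorphM /= -rmorphD /=.
rewrite -(rmorph0 cC); congr (cC _).
have chP : 2%N \in [pchar P].
  rewrite !inE /= -(rmorph_nat (@polyC {poly F} \o @polyC F)).
  by rewrite (pcharf0 chF) rmorph0.
by apply: (eq_mod2 chP (c := cs ^+ 2 * pu ^+ 4 * pv ^+ 4)); ring.
Qed.

Definition fiber_fun (r : R) : Cs := fiber_poly (repr r).

Lemma fiber_fun_toR p : fiber_fun (toR p) = fiber_poly p.
Proof.
have /eqP/toRP [w] : toR (repr (toR p)) = toR p by rewrite /toR reprK.
move=> /(congr1 fiber_poly); rewrite rmorphB rmorphM /= fiber_poly_rel mulr0.
by move/subr0_eq.
Qed.

Lemma fiber_fun_zmod : zmod_morphism fiber_fun.
Proof.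
move=> a b; have [p ->] := toR_surj a; have [q ->] := toR_surj b.
by rewrite -rmorphB !fiber_fun_toR rmorphB.
Qed.
HB.instance Definition _ := GRing.isZmodMorphism.Build R Cs fiber_fun fiber_fun_zmod.

Lemma fiber_fun_monoid : monoid_morphism fiber_fun.
Proof.
split=> [|a b]; first by rewrite -(rmorph1 (@toR F)) fiber_fun_toR rmorph1.
have [p ->] := toR_surj a; have [q ->] := toR_surj b.
by rewrite -rmorphM !fiber_fun_toR rmorphM.
Qed.
HB.instance Definition _ := GRing.isMonoidMorphism.Build R Cs fiber_fun fiber_fun_monoid.

Definition fiber : {rmorphism R -> Cs} := fiber_fun.

Lemma fiber_toR p : fiber (toR p) = fiber_poly p.
Proof. exact: fiber_fun_toR. Qed.

Lemma fiber_vars : [/\ fiber Rx = qX, fiber Ry = qY & fiber Rz = cC (pu * pv)].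
Proof. by have [hx hy hz _] := fiber_poly_vars; split; rewrite fiber_toR. Qed.

Lemma fiber_iota3 h : fiber (iota3 h) = fiber_xyz s h.
Proof.
have [ix iy iz] := iota3_vars F; have [hx hy hz] := fiber_vars.
rewrite -[LHS]/((fiber \o @iota3 F) h); apply: mpoly_hom_eq => [c|].
  by rewrite [LHS]/(fiber (iota3 _)) /iota3 mmapC /= fiber_fun_toR /fiber_poly mmapC /fiber_xyz mmapC.
by apply: pick3P; rewrite [LHS]/(fiber (iota3 _)) ?ix ?iy ?iz ?hx ?hy ?hz -[RHS]/(fiber_xyz s _) /fiber_xyz mmapX mmap1U.
Qed.

Lemma fiber_multS (g : {poly F}) :
  fiber (toR (map_poly (@mpolyC 4 F) g).[polT F]) = cC (g.[s ^+ 2])%:P%:P.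
Proof.
have [_ _ _ ht] := fiber_poly_vars.
rewrite fiber_toR -horner_map /= ht -map_poly_comp /=.
have -> : map_poly (fiber_poly \o @mpolyC 4 F) g = map_poly (cC \o (@polyC {poly F} \o @polyC F)) g.
  by apply: eq_map_poly => c; rewrite /= /fiber_poly mmapC.
have -> : cC (cs ^+ 2) = (cC \o (@polyC {poly F} \o @polyC F)) (s ^+ 2).
  by rewrite /= !rmorphXn.
by rewrite horner_map.
Qed.

Lemma quadratic_qext : quadratic (cC cs) (cC pu) (cC pv) qX qY.
Proof.
split; [rewrite qx2 | rewrite qy2]; by rewrite (rmorphM _ cs) (rmorphXn _ 4) (rmorphM _ pu).
Qed.

(** In each coordinate, the coefficient of u^i v^j vanishes on (u^(2^e), v^(2^e)) once 2^e exceeds i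
    and j; e = i + j is enough. *)
Lemma monomial_ideals_separated (c : Cs) :
  (forall e, exists c1 c2, c = cC pu ^+ (2 ^ e) * c1 + cC pv ^+ (2 ^ e) * c2) -> c = 0.
Proof.
move=> hc.
have key (w : P) : (forall e, exists w1 w2, w = pu ^+ (2 ^ e) * w1 + pv ^+ (2 ^ e) * w2) -> w = 0.
  move=> hw; apply/polyP => j; apply/polyP => i; rewrite !coef0.
  have [w1 [w2 ->]] := hw (i + j)%N.
  have lt : (i + j < 2 ^ (i + j))%N by rewrite ltn_expl.
  have i_lt : (i < 2 ^ (i + j))%N by apply: leq_ltn_trans lt; rewrite leq_addr.
  have j_lt : (j < 2 ^ (i + j))%N by apply: leq_ltn_trans lt; rewrite leq_addl.
  rewrite coefD /coordU /coordV -polyC_exp coefCM coefXnM j_lt addr0.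
  by rewrite coefXnM i_lt.
have co e : exists c1 c2 : Cs, [/\ c.1.1 = pu ^+ (2 ^ e) * c1.1.1 + pv ^+ (2 ^ e) * c2.1.1,
    c.1.2 = pu ^+ (2 ^ e) * c1.1.2 + pv ^+ (2 ^ e) * c2.1.2,
    c.2.1 = pu ^+ (2 ^ e) * c1.2.1 + pv ^+ (2 ^ e) * c2.2.1
  & c.2.2 = pu ^+ (2 ^ e) * c1.2.2 + pv ^+ (2 ^ e) * c2.2.2].
  have [c1 [c2 ->]] := hc e; exists c1, c2.
  by rewrite -!rmorphXn /= !qcst_mulE.
by apply: qext_eq0; apply: key => e; have [c1 [c2 [*]]] := co e; do 2 eexists; eassumption.
Qed.

End Fiber.

Lemma exprM_mul (A : comNzRingType) (y z : A) k M :
  y ^+ (k * M) * z ^+ (k * M) = (y ^+ k * z ^+ k) ^+ M.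
Proof. by rewrite exprMn -!exprM. Qed.

Lemma rmorph_inverse (A B : comNzRingType) (f : {rmorphism A -> B}) (a b : A) :
  a * b = 1 -> f a * f b = 1.
Proof. by move=> ab; rewrite -rmorphM ab rmorph1. Qed.

Lemma in_ideal3_map (A B : comNzRingType) (f : {rmorphism A -> B}) (x y z r : A) :
  in_ideal3 x y z r -> in_ideal3 (f x) (f y) (f z) (f r).
Proof. by move=> [a [b [c ->]]]; exists (f a), (f b), (f c); rewrite !rmorphD !rmorphM. Qed.

Lemma in_ideal3_unit (A : comNzRingType) (k k' c x y z w : A) (M : nat) : k * k' = 1 ->
  in_ideal3 x y z (c * (k' * w) ^+ M) -> in_ideal3 x y z (c * w ^+ M).
Proof.
move=> kk h; have -> : c * w ^+ M = k ^+ M * (c * (k' * w) ^+ M).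
  by rewrite mulrCA -exprMn mulrA kk mul1r.
exact: in_ideal3M.
Qed.

(** * Failure of membership before localization *)

Section NotInLocalization.
Variable F : closedFieldType.
Hypothesis chF : 2%N \in [pchar F].
Local Notation R := (hypR F).

(** The hypothesis is applied at the exponents 4^(n+2) 2^e, where [membership_bound] with N = n + 1
    puts c in (u^(2^e), v^(2^e)) for every e. *)
Lemma destabilizing_membership n (s : F) (c : qext (s%:P%:P * coordU F ^+ 4) (s%:P%:P * coordV F ^+ 4) (coordU F * coordV F)) :
    destabilizing n s ->
  (forall e, (1 <= e)%N -> let M := (2 ^ e)%N in
    let cC := @qcst _ (s%:P%:P * coordU F ^+ 4) (s%:P%:P * coordV F ^+ 4) (coordU F * coordV F) in
    in_ideal3 (qx _ _ _ ^+ (4 * M)) (qy _ _ _ ^+ (4 * M)) (cC (coordU F * coordV F) ^+ (4 * M))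
      (c * (qy _ _ _ ^+ (3 * M) * cC (coordU F * coordV F) ^+ (3 * M)))) ->
  c = 0.
Proof.
move=> gs hc; have [g [lam [h0 hN hg hl]]] := destabilizing_chain chF gs.
have [s0 _] := destabilizing_neq0 gs.
set cC := @qcst _ (s%:P%:P * coordU F ^+ 4) (s%:P%:P * coordV F ^+ 4) (coordU F * coordV F).
pose k : {rmorphism F -> _} := cC \o (@polyC {poly F} \o @polyC F).
apply: monomial_ideals_separated => e.
have M1 : (1 <= 2 * n.+2 + e)%N by lia.
have [al [be [ga ec]]] := hc _ M1.
have eM : (2 ^ (2 * n.+2 + e) = 4 ^ n.+2 * 2 ^ e)%N by rewrite expnD expnM.
rewrite eM (rmorphM cC) in ec.
apply: (membership_bound (pchar_qext chF s) (s := k s) (s' := k s^-1) (N := n.+1)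
  (g := k \o g) (lam := k \o lam) _ _ _ _ _ (quadratic_qext s)
  (qext_regular_pair _ _ _ (regular_pair_poly F)) ec).
- exact: (rmorph_inverse k (mulVf s0)).
- by rewrite -[LHS]/(k (lam 0%N)) h0 rmorphXn.
- by rewrite -[LHS]/(k (lam n.+1)) hN rmorph1.
- by move=> j hj; rewrite -(rmorphXn k) -(hg _ hj) rmorphM.
- by move=> j hj; rewrite -(rmorphXn k) -[LHS]/(k (lam j)) (hl _ hj) rmorphD rmorphM.
Qed.

Lemma tight_closure_multiplier (r : R) : tight_closure 2 (idealI F) r ->
  exists h, h != 0 /\ forall e, (1 <= e)%N ->
    in_ideal3 (Rx ^+ (4 * 2 ^ e)) (Ry ^+ (4 * 2 ^ e)) (Rz ^+ (4 * 2 ^ e))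
      (iota3 h * r ^+ (2 ^ e)).
Proof.
case=> c [c0 hc]; have [d [h [h0 e]]] := clear_z_neq0 c0.
exists h; split=> // k k1; rewrite -e -mulrA; apply: in_ideal3M.
by apply: bracket_power3; [exact: pchar_hypR | apply: hc].
Qed.

(** Sums of elements of the tight closure are handled by multiplying their multipliers. As these are
    polynomials in x, y, z, their product is nonzero without R being known to be a domain. *)
Lemma ideal_gen_multiplier (r : R) : ideal_gen (tight_closure 2 (idealI F)) r ->
  exists h, h != 0 /\ forall e, (1 <= e)%N ->
    in_ideal3 (Rx ^+ (4 * 2 ^ e)) (Ry ^+ (4 * 2 ^ e)) (Rz ^+ (4 * 2 ^ e))
      (iota3 h * r ^+ (2 ^ e)).
Proof.
move: r; apply: ideal_gen_ind.
- exists 1; split=> [|e _]; first exact: oner_neq0.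
  by rewrite expr0n expn_eq0 mulr0; apply: in_ideal3_0.
- move=> a b [h [h0 ha]] [h' [h'0 hb]]; exists (h * h'); split=> [|e e1].
    by rewrite mulf_neq0.
  rewrite (exprD_pow2 (pchar_hypR chF)) mulrDr rmorphM /=; apply: in_ideal3D.
    by rewrite mulrAC mulrC; apply: in_ideal3M; apply: ha.
  by rewrite -mulrA; apply: in_ideal3M; apply: hb.
- move=> c a /tight_closure_multiplier [h [h0 ha]]; exists h; split=> // e e1.
  by rewrite exprMn mulrCA; apply: in_ideal3M; apply: ha.
Qed.

Lemma not_in_localized_closure :
  ~ loc_ideal (multS F) (tight_closure 2 (idealI F)) (loc_of (multS F) (Ry ^+ 3 * Rz ^+ 3)).
Proof.
case/loc_idealP => w /asboolP [g g0 ->] /ideal_gen_multiplier [h [h0 hh]].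
have [B B0 hB] := fiber_xyz_neq0 chF h0.
(* On the fiber at s the denominator g(t) becomes the scalar g(s^2). The chosen s must keep both
   this scalar and the image of h nonzero. *)
have G0 : B * (g \Po 'X^2) != 0.
  by rewrite mulf_neq0 // comp_poly_eq0 // size_polyXn.
have [n [s [gs]]] := destabilizing_avoid chF G0.
rewrite hornerM horner_comp hornerXn mulf_eq0 negb_or => /andP [/hB + gs0].
apply/negP; rewrite negbK; apply/eqP.
apply: (destabilizing_membership gs) => e e1 M cC.
have [hx hy hz] := fiber_vars chF s.
have := in_ideal3_map (fiber chF s) (hh e e1).
rewrite !(rmorphXn (fiber chF s)) (rmorphM (fiber chF s)) (rmorphXn (fiber chF s)).
rewrite (rmorphM (fiber chF s) (toR _)) (rmorphM (fiber chF s) (Ry ^+ 3)).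
rewrite !(rmorphXn (fiber chF s)) hx hy hz fiber_iota3 fiber_multS => hm.
rewrite [X in in_ideal3 _ _ _ (_ * X)](_ : _ = (qy _ _ _ ^+ 3 * cC (coordU F * coordV F) ^+ 3) ^+ M).
  apply: (in_ideal3_unit (k := cC (g.[s ^+ 2]^-1)%:P%:P) _ hm).
  exact: (rmorph_inverse (cC \o (@polyC {poly F} \o @polyC F)) (mulVf gs0)).
exact: exprM_mul.
Qed.

End NotInLocalization.

(* A determinant trick: a finite family spanning a module N with N <= J + t N is killed
   modulo J by the determinant of 1 - t B, which is 1 at t = 0. *)
Lemma nakayama_poly (F A : comNzRingType) (phi : {rmorphism {poly F} -> A}) (J : A -> Prop)
    (J0 : J 0) (JD : forall a b, J a -> J b -> J (a + b)) (JM : forall c a, J a -> J (c * a))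
    n (v : 'I_n -> A) :
  (forall i, exists (B : 'I_n -> {poly F}) j, J j /\
     v i = j + phi 'X * \sum_(k < n) phi (B k) * v k) ->
  exists2 w : {poly F}, w.[0] = 1 & forall i, J (phi w * v i).
Proof.
move=> h.
pose B i := projT1 (cid (h i)).
have hB i : exists j, J j /\ v i = j + phi 'X * \sum_(k < n) phi (B i k) * v k.
  exact: projT2 (cid (h i)).
pose j i := projT1 (cid (hB i)).
have hj i : J (j i) /\ v i = j i + phi 'X * \sum_(k < n) phi (B i k) * v k.
  exact: projT2 (cid (hB i)).
pose D : 'M[{poly F}]_n := 1%:M - 'X *: (\matrix_(i, k) B i k).
have eD : map_mx phi D *m (\col_i v i) = \col_i j i.
  apply/matrixP => i k; rewrite !mxE.
  transitivity (\sum_(l < n) ((i == l)%:R * v l - phi 'X * (phi (B i l) * v l))).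
    apply: eq_bigr => l _; rewrite !mxE rmorphB rmorphM /= rmorphMn /= rmorph1; ring.
  rewrite sumrB -mulr_sumr (bigD1 i) //= eqxx mul1r big1 => [|l /negbTE ne].
    by rewrite addr0 {1}(hj i).2 addrK.
  by rewrite eq_sym ne mul0r.
exists (\det D).
  rewrite -/(horner_eval 0 _) -det_map_mx (_ : map_mx _ D = 1%:M) ?det1 //.
  apply/matrixP => i k; rewrite !mxE rmorphB rmorphM rmorph_nat /= /horner_eval.
  by rewrite hornerX mul0r subr0.
move=> i; have := congr1 (fun V : 'cV_n => (map_mx phi (\adj D) *m V) i ord0) eD.
rewrite mulmxA -map_mxM mul_adj_mx map_scalar_mx mul_scalar_mx !mxE => ->.
apply: big_ind => // k _; rewrite !mxE; apply: JM; exact: (hj k).1.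
Qed.

(** * Degeneration at t = 0 *)

Section Degeneration.
Variables (F A : comNzRingType) (phi : {rmorphism {poly F} -> A}).
Hypothesis chA : 2%N \in [pchar A].
Local Notation t := (phi 'X).
Variable z : A.

(* X and Y have degree 2 and z has degree 1. *)
Inductive graded (X Y : A) (d : nat) : A -> Prop :=
| Graded0 : graded X Y d 0
| GradedD p q : graded X Y d p -> graded X Y d q -> graded X Y d (p + q)
| GradedM a b k : (2 * a + 2 * b + k = d)%N -> graded X Y d (X ^+ a * Y ^+ b * z ^+ k).

Lemma graded_mul X Y d d' p q : graded X Y d p -> graded X Y d' q -> graded X Y (d + d') (p * q).
Proof.
move=> hp hq; elim: hp => [|p1 p2 _ h1 _ h2|a b k ed].
- by rewrite mul0r; apply: Graded0.
- by rewrite mulrDl; apply: GradedD.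
- elim: hq => [|q1 q2 _ h1 _ h2|a' b' k' ed'].
  + by rewrite mulr0; apply: Graded0.
  + by rewrite mulrDr; apply: GradedD.
  + have -> : X ^+ a * Y ^+ b * z ^+ k * (X ^+ a' * Y ^+ b' * z ^+ k')
       = X ^+ (a + a') * Y ^+ (b + b') * z ^+ (k + k') by rewrite !exprD; ring.
    by apply: GradedM; lia.
Qed.

Lemma graded_sym X Y d p : graded X Y d p -> graded Y X d p.
Proof.
elim=> [|p1 p2 _ h1 _ h2|a b k ed]; [exact: Graded0 | exact: GradedD |].
by rewrite (mulrC (X ^+ a)); apply: GradedM; lia.
Qed.

(** A monomial divisible by XY is a multiple of t, so only these monomials need attention modulo t;
    in characteristic 2 squaring creates no mixed ones. *)
Inductive pure (X Y : A) (d : nat) : A -> Prop :=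
| Pure0 : pure X Y d 0
| PureD p q : pure X Y d p -> pure X Y d q -> pure X Y d (p + q)
| PureX a : (2 * a <= d)%N -> pure X Y d (X ^+ a * z ^+ (d - 2 * a))
| PureY a : (2 * a <= d)%N -> pure X Y d (Y ^+ a * z ^+ (d - 2 * a)).

Lemma pure_graded X Y d p : pure X Y d p -> graded X Y d p.
Proof.
elim=> [|p1 p2 _ h1 _ h2|a ed|a ed]; [exact: Graded0 | exact: GradedD | |].
- have := @GradedM X Y d a 0 (d - 2 * a); rewrite mulr1; apply; lia.
- have := @GradedM X Y d 0 a (d - 2 * a); rewrite mul1r; apply; lia.
Qed.

Lemma pure_sqr X Y d p : pure X Y d p -> pure X Y (2 * d) (p ^+ 2).
Proof.
elim=> [|p1 p2 _ h1 _ h2|a ed|a ed].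
- by rewrite expr0n; apply: Pure0.
- by rewrite (exprD_pow2 chA _ _ 1); apply: PureD.
- rewrite exprMn -!exprM (_ : (d - 2 * a) * 2 = 2 * d - 2 * (a * 2))%N; last by lia.
  by apply: PureX; lia.
- rewrite exprMn -!exprM (_ : (d - 2 * a) * 2 = 2 * d - 2 * (a * 2))%N; last by lia.
  by apply: PureY; lia.
Qed.

Section Coordinates.
Variables x y : A.
Let X := x ^+ 2 + y * z.
Let Y := y ^+ 2 + x * z.

(** Squaring z^(2^e-1) u and using x^2 = X + yz or y^2 = Y + xz yields a pure term and a new tail in
    which x and y are exchanged; hence u is only known to be one of them. *)
Lemma expr_pow2_pure (b : bool) e : exists r, pure X Y (2 ^ e) r /\
  exists u, (u = x \/ u = y) /\ (if b then x else y) ^+ (2 ^ e) = r + z ^+ (2 ^ e - 1) * u.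
Proof.
elim: e => [|e [r [hr [u [hu eu]]]]].
  exists 0; split; first exact: Pure0.
  by exists (if b then x else y); split; [case: b; [left|right] | rewrite add0r mul1r expr1].
have e0 : (0 < 2 ^ e)%N by rewrite expn_gt0.
have ez : z ^+ (2 ^ e.+1 - 1) = z ^+ (2 ^ e.+1 - 2) * z.
  by rewrite -exprSr; congr (_ ^+ _); rewrite expnS; lia.
have ez2 : (z ^+ (2 ^ e - 1)) ^+ 2 = z ^+ (2 ^ e.+1 - 2).
  by rewrite -exprM; congr (_ ^+ _); rewrite expnS; lia.
have -> : (if b then x else y) ^+ (2 ^ e.+1) = r ^+ 2 + z ^+ (2 ^ e.+1 - 2) * u ^+ 2.
  by rewrite [in LHS]expnSr exprM eu (exprD_pow2 chA _ _ 1) expn1 (exprMn 2 _ u) ez2.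
have e2 : (2 * 1 <= 2 ^ e.+1)%N by rewrite expnS; lia.
have hr2 : pure X Y (2 ^ e.+1) (r ^+ 2) by rewrite expnS; apply: pure_sqr.
case: hu => ->.
- exists (r ^+ 2 + X ^+ 1 * z ^+ (2 ^ e.+1 - 2 * 1)); split.
    by apply: PureD => //; apply: PureX.
  exists y; split; first by right.
  by apply/esym/(eq_mod2 chA (c := z ^+ (2 ^ e.+1 - 1) * y)); rewrite muln1 ez /X; ring.
- exists (r ^+ 2 + Y ^+ 1 * z ^+ (2 ^ e.+1 - 2 * 1)); split.
    by apply: PureD => //; apply: PureY.
  exists x; split; first by left.
  by apply/esym/(eq_mod2 chA (c := z ^+ (2 ^ e.+1 - 1) * x)); rewrite muln1 ez /Y; ring.
Qed.

Lemma expr_4pow2 e : let M := (2 ^ e)%N in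
  x ^+ (4 * M) = X ^+ (2 * M) + Y ^+ M * z ^+ (2 * M) + x ^+ M * z ^+ (3 * M).
Proof.
have e4 : x ^+ 4 = X ^+ 2 + Y * z ^+ 2 + x * z ^+ 3.
  apply/esym/(eq_mod2 chA (c := x ^+ 2 * y * z + y ^+ 2 * z ^+ 2 + x * z ^+ 3)).
  by rewrite /X /Y; ring.
move=> M; rewrite exprM e4 (exprD_pow2 chA (X ^+ 2 + _)) (exprD_pow2 chA (X ^+ 2)) -/M.
by rewrite (exprMn M Y) (exprMn M x) -!exprM.
Qed.

End Coordinates.

Section Span.
Variable e : nat.
Local Notation M := (2 ^ e)%N.
Variables x y : A.
Hypothesis rel : (x ^+ 2 + y * z) * (y ^+ 2 + x * z) = t * z ^+ 4.
Let X := x ^+ 2 + y * z.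
Let Y := y ^+ 2 + x * z.

Definition pow_ideal (r : A) : Prop := in_ideal3 (x ^+ (4 * M)) (y ^+ (4 * M)) (z ^+ (4 * M)) r.

(** The error term is again t z times something graded of degree 6M: this closure is what the
    determinant trick requires. *)
Definition pow_ideal_t (r : A) : Prop :=
  exists j g, [/\ pow_ideal j, graded X Y (6 * M) g & r = j + t * (z * g)].

Lemma pow_ideal_tD a b : pow_ideal_t a -> pow_ideal_t b -> pow_ideal_t (a + b).
Proof.
move=> [j [g [hj hg ->]]] [j' [g' [hj' hg' ->]]]; exists (j + j'), (g + g'); split.
- exact: in_ideal3D.
- exact: GradedD.
- by ring.
Qed.

Lemma pow_ideal_tJ a : pow_ideal a -> pow_ideal_t a.
Proof. by move=> ha; exists a, 0; split=> //; [exact: Graded0 | rewrite !mulr0 addr0]. Qed.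

Lemma pow_ideal_t_cancel a b : pow_ideal_t (a + b) -> pow_ideal_t b -> pow_ideal_t a.
Proof.
move=> hab hb; have := pow_ideal_tD hab hb.
by rewrite -addrA (addrr_pchar2 chA) addr0.
Qed.

Lemma pow_ideal_z k r : (4 * M <= k)%N -> pow_ideal (z ^+ k * r).
Proof.
by move=> /subnKC <-; exists 0, 0, (z ^+ (k - 4 * M) * r); rewrite exprD; ring.
Qed.

Lemma pow_ideal_t_mixed a b k : (2 * a.+1 + 2 * b.+1 + k = 6 * M)%N ->
  pow_ideal_t (z * (X ^+ a.+1 * Y ^+ b.+1 * z ^+ k)).
Proof.
move=> ed; exists 0, (X ^+ a * Y ^+ b * z ^+ (k + 4)); split.
- exact: in_ideal3_0.
- by apply: GradedM; lia.
- transitivity (z * X ^+ a * Y ^+ b * z ^+ k * (X * Y)); first by rewrite !exprS; ring.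
  by rewrite rel exprD; ring.
Qed.

(** The X-terms of r have exponent at most M/2, so they give X-exponents below k + M, covered by the
    induction hypothesis. Each Y-term of positive exponent gives a mixed monomial, since k > 0. *)
Lemma pow_ideal_t_pure_step k i r : pure X Y M r -> (0 < k <= M)%N -> (k + M <= i)%N ->
  (forall i', (i' < i)%N -> (i' <= 3 * M)%N -> pow_ideal_t (z * (X ^+ i' * z ^+ (6 * M - 2 * i')))) ->
  pow_ideal_t (z * (X ^+ k * z ^+ (5 * M - 2 * k) * r)).
Proof.
have M0 : (0 < M)%N by rewrite expn_gt0.
move=> hr /andP [k0 kM] ki IH; elim: hr => [|p q _ h1 _ h2|a ha|a ha].
- by rewrite !mulr0; apply/pow_ideal_tJ/in_ideal3_0.
- by rewrite !mulrDr; apply: pow_ideal_tD.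
- have -> : X ^+ k * z ^+ (5 * M - 2 * k) * (X ^+ a * z ^+ (M - 2 * a))
     = X ^+ (k + a) * z ^+ (6 * M - 2 * (k + a)).
    rewrite (_ : 6 * M - 2 * (k + a) = 5 * M - 2 * k + (M - 2 * a))%N; last by lia.
    by rewrite !(exprD _ k) (exprD z (5 * M - 2 * k)); ring.
  by apply: IH; lia.
- case: a ha => [|a] ha.
    have -> : X ^+ k * z ^+ (5 * M - 2 * k) * (Y ^+ 0 * z ^+ (M - 2 * 0))
       = X ^+ k * z ^+ (6 * M - 2 * k).
      rewrite (_ : 6 * M - 2 * k = 5 * M - 2 * k + (M - 2 * 0))%N; last by lia.
      by rewrite (exprD z (5 * M - 2 * k)); ring.
    by apply: IH; lia.
  have -> : X ^+ k * z ^+ (5 * M - 2 * k) * (Y ^+ a.+1 * z ^+ (M - 2 * a.+1))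
     = X ^+ k.-1.+1 * Y ^+ a.+1 * z ^+ (5 * M - 2 * k + (M - 2 * a.+1)).
    by rewrite prednK // (exprD z); ring.
  by apply: pow_ideal_t_mixed; lia.
Qed.

(** For i at most M the power of z is already large enough. Otherwise X^i is reduced through the
    expansion of y^(4M), which contains X^M z^(2M), or beyond 2M through that of x^(4M), which
    contains X^(2M). Besides a mixed monomial this leaves a tail in y^M or x^M, whose pure part has
    smaller X-exponent. *)
Lemma pow_ideal_t_pure i : (i <= 3 * M)%N -> pow_ideal_t (z * (X ^+ i * z ^+ (6 * M - 2 * i))).
Proof.
have M0 : (0 < M)%N by rewrite expn_gt0.
elim/ltn_ind: i => i IH iM.
have [i_le|i_gt] := leqP i M.
  apply: pow_ideal_tJ; rewrite mulrCA mulrC -!mulrA.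
  by rewrite mulrC -!mulrA; apply: pow_ideal_z; lia.
have tail k b u r : (0 < k <= M)%N -> (k + M <= i)%N -> pure X Y M r ->
    (if b then x else y) ^+ M = r + z ^+ (M - 1) * u ->
    pow_ideal_t (z * (X ^+ k * z ^+ (5 * M - 2 * k) * (if b then x else y) ^+ M)).
  move=> hk ki hr ->; rewrite !mulrDr; apply: pow_ideal_tD.
    by apply: (pow_ideal_t_pure_step hr hk ki) => i' /IH h h'; apply: h; lia.
  (* The total exponent of z is 6M - 2k, which is exactly 4M at k = M: the multiplier z is
     indispensable in this count. *)
  have -> : z * (X ^+ k * z ^+ (5 * M - 2 * k) * (z ^+ (M - 1) * u))
     = z ^+ (1 + (5 * M - 2 * k + (M - 1))) * (X ^+ k * u) by rewrite !(exprD z); ring.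
  by apply/pow_ideal_tJ/pow_ideal_z; lia.
have [i_le2|i_gt2] := leqP i (2 * M).
- pose k := (i - M)%N.
  have hk : (0 < k <= M)%N by rewrite /k; lia.
  have [r [hr [u [_ eu]]]] := expr_pow2_pure x y false e.
  have e4 := expr_4pow2 y x e.
  apply: (pow_ideal_t_cancel (b := z * (X ^+ k.-1.+1 * Y ^+ (2 * M).-1.+1 * z ^+ (2 * M - 2 * k))
     + z * (X ^+ k * z ^+ (5 * M - 2 * k) * (if false then x else y) ^+ M))).
    apply: pow_ideal_tJ; exists 0, (z * X ^+ k * z ^+ (2 * M - 2 * k)), 0.
    rewrite mul0r add0r mul0r addr0 e4 -/X -/Y !prednK; [|lia|lia].
    have -> : X ^+ i = X ^+ k * X ^+ M by rewrite -exprD; congr (_ ^+ _); rewrite /k; lia.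
    have -> : z ^+ (6 * M - 2 * i) = z ^+ (2 * M - 2 * k) * z ^+ (2 * M).
      by rewrite -exprD; congr (_ ^+ _); rewrite /k; lia.
    have -> : z ^+ (5 * M - 2 * k) = z ^+ (2 * M - 2 * k) * z ^+ (3 * M).
      by rewrite -exprD; congr (_ ^+ _); rewrite /k; lia.
    by ring.
  apply: pow_ideal_tD; first by apply: pow_ideal_t_mixed; rewrite /k; lia.
  by apply: (tail _ false u r) => //; rewrite /k; lia.
- pose k := (i - 2 * M)%N.
  have hk : (0 < k <= M)%N by rewrite /k; lia.
  have [r [hr [u [_ eu]]]] := expr_pow2_pure x y true e.
  have e4 := expr_4pow2 x y e.
  apply: (pow_ideal_t_cancel (b := z * (X ^+ k.-1.+1 * Y ^+ M.-1.+1 * z ^+ (4 * M - 2 * k))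
     + z * (X ^+ k * z ^+ (5 * M - 2 * k) * (if true then x else y) ^+ M))).
    apply: pow_ideal_tJ; exists (z * X ^+ k * z ^+ (2 * M - 2 * k)), 0, 0.
    rewrite mul0r addr0 mul0r addr0 e4 -/X -/Y !prednK; [|lia|lia].
    have -> : X ^+ i = X ^+ k * X ^+ (2 * M) by rewrite -exprD; congr (_ ^+ _); rewrite /k; lia.
    have -> : z ^+ (6 * M - 2 * i) = z ^+ (2 * M - 2 * k).
      by congr (_ ^+ _); rewrite /k; lia.
    have -> : z ^+ (4 * M - 2 * k) = z ^+ (2 * M - 2 * k) * z ^+ (2 * M).
      by rewrite -exprD; congr (_ ^+ _); rewrite /k; lia.
    have -> : z ^+ (5 * M - 2 * k) = z ^+ (2 * M - 2 * k) * z ^+ (3 * M).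
      by rewrite -exprD; congr (_ ^+ _); rewrite /k; lia.
    by ring.
  apply: pow_ideal_tD; first by apply: pow_ideal_t_mixed; rewrite /k; lia.
  by apply: (tail _ true u r) => //; rewrite /k; lia.
Qed.

End Span.

Lemma in_ideal3_swap (a b c r : A) : in_ideal3 a b c r -> in_ideal3 b a c r.
Proof. by move=> [i [j [k ->]]]; exists j, i, k; rewrite (addrC (i * a)). Qed.

Lemma pow_ideal_t_swap e x y r : pow_ideal_t e x y r -> pow_ideal_t e y x r.
Proof.
move=> [j [g [hj hg ->]]]; exists j, g; split=> //; first exact: in_ideal3_swap.
exact: graded_sym.
Qed.

Section Conclusion.
Variables (e : nat) (x y : A).
Hypothesis rel : (x ^+ 2 + y * z) * (y ^+ 2 + x * z) = t * z ^+ 4.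
Local Notation M := (2 ^ e)%N.
Local Notation X := (x ^+ 2 + y * z).
Local Notation Y := (y ^+ 2 + x * z).

Lemma pow_ideal_t_monomial a b k : (2 * a + 2 * b + k = 6 * M)%N ->
  pow_ideal_t e x y (z * (X ^+ a * Y ^+ b * z ^+ k)).
Proof.
case: b => [|b] ed.
  rewrite mulr1 (_ : k = 6 * M - 2 * a)%N; last by lia.
  by apply: pow_ideal_t_pure => //; lia.
case: a ed => [|a] ed; last exact: pow_ideal_t_mixed.
rewrite mul1r (_ : k = 6 * M - 2 * b.+1)%N; last by lia.
apply: pow_ideal_t_swap; apply: pow_ideal_t_pure; last by lia.
by rewrite mulrC.
Qed.

Lemma graded_annihilated : exists2 w : {poly F}, w.[0] = 1 &
  forall g, graded X Y (6 * M) g -> pow_ideal e x y (phi w * (z * g)).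
Proof.
pose T : finType := ('I_(3 * M).+1 * 'I_(3 * M).+1)%type.
(* Exponent pairs of too large degree get the value 0, so that truncated subtraction produces no
   spurious generator. *)
pose vT (p : T) := if (p.1 + p.2 <= 3 * M)%N then
  z * (X ^+ p.1 * Y ^+ p.2 * z ^+ (6 * M - 2 * p.1 - 2 * p.2)) else 0.
pose v (i : 'I_#|T|) := vT (enum_val i).
have hgen g : graded X Y (6 * M) g ->
    exists B : 'I_#|T| -> {poly F}, z * g = \sum_(k < #|T|) phi (B k) * v k.
  elim=> [|p q _ [B1 e1] _ [B2 e2]|a b k ed].
  - by exists (fun=> 0); rewrite mulr0 big1 // => i _; rewrite rmorph0 mul0r.
  - exists (fun i => B1 i + B2 i); rewrite mulrDr e1 e2 -big_split.
    by apply: eq_bigr => i _; rewrite rmorphD mulrDl.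
  - have ha : (a < (3 * M).+1)%N by lia.
    have hb : (b < (3 * M).+1)%N by lia.
    pose p : T := (Ordinal ha, Ordinal hb).
    exists (fun i => (i == enum_rank p)%:R).
    rewrite (bigD1 (enum_rank p)) //= eqxx rmorph1 mul1r big1 => [|i /negbTE ->].
      rewrite addr0 /v enum_rankK /vT /= ifT; last by lia.
      by rewrite (_ : k = 6 * M - 2 * a - 2 * b)%N //; lia.
    by rewrite rmorph0 mul0r.
have [i|w w0 hw] := nakayama_poly (phi := phi) (J := pow_ideal e x y) (v := v)
  (in_ideal3_0 _ _ _) (@in_ideal3D _ _ _ _) (@in_ideal3M _ _ _ _).
  have : pow_ideal_t e x y (v i).
    rewrite /v /vT; case: ifP => h; last exact/pow_ideal_tJ/in_ideal3_0.
    by apply: pow_ideal_t_monomial; move: h; case: (enum_val i) => /= i1 i2; lia.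
  move=> [j [g [hj hg ->]]]; have [B eB] := hgen _ hg.
  by exists B, j; rewrite eB.
exists w => // g /hgen [B ->].
rewrite mulr_sumr; apply: (big_ind (pow_ideal e x y)) => [|a b|k _].
- exact: in_ideal3_0.
- exact: in_ideal3D.
- by rewrite mulrCA; apply: in_ideal3M; apply: hw.
Qed.

(** Write y^M = r + z^(M-1) u with r pure of degree M. Then r^3 z^(3M) is graded of degree 6M, and
    y^(3M) - r^3 is divisible by z^(M-1), which z z^(3M) completes to z^(4M). *)
Theorem degenerate_membership : exists2 w : {poly F}, w.[0] = 1 &
  in_ideal3 (x ^+ (4 * M)) (y ^+ (4 * M)) (z ^+ (4 * M)) (phi w * (z * (y ^+ 3 * z ^+ 3) ^+ M)).
Proof.
have [w w0 hw] := graded_annihilated; exists w => //.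
have [r [hr [u [_ eu]]]] := expr_pow2_pure x y false e.
have M0 : (0 < M)%N by rewrite expn_gt0.
have hg : graded X Y (6 * M) (r * r * r * z ^+ (3 * M)).
  have h := pure_graded hr.
  have hz : graded X Y (3 * M) (z ^+ (3 * M)).
    by have := @GradedM X Y (3 * M) 0 0 (3 * M) (erefl _); rewrite !mul1r.
  have := graded_mul (graded_mul (graded_mul h h) h) hz.
  by rewrite (_ : M + M + M + 3 * M = 6 * M)%N //; lia.
have -> : z * (y ^+ 3 * z ^+ 3) ^+ M
   = z * (r * r * r * z ^+ (3 * M))
     + z ^+ (4 * M) * (u * (y ^+ M * y ^+ M + y ^+ M * r + r * r)).
  have ez : z ^+ (4 * M) = z * z ^+ (M - 1) * z ^+ (3 * M).
    by rewrite -exprS -exprD; congr (_ ^+ _); lia.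
  have eu' : z ^+ (M - 1) * u = y ^+ M - r by rewrite eu addrC addKr.
  rewrite -exprM_mul (mulnC 3) (exprM y).
  rewrite (mulnC M) ez.
  transitivity (z * (r * r * r * z ^+ (3 * M)) + z * z ^+ (3 * M)
    * (z ^+ (M - 1) * u) * (y ^+ M * y ^+ M + y ^+ M * r + r * r)); last by ring.
  by rewrite eu'; ring.
rewrite mulrDr; apply: in_ideal3D; first exact: hw.
exists 0, 0, (phi w * (u * (y ^+ M * y ^+ M + y ^+ M * r + r * r))); ring.
Qed.

End Conclusion.
End Degeneration.

(** * Membership after localization *)

Section InClosure.
Variable F : closedFieldType.
Hypothesis chF : 2%N \in [pchar F].
Local Notation R := (hypR F).

Definition tpoly : {poly F} -> R :=
  @toR F \o horner_eval (polT F) \o map_poly (@mpolyC 4 F).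
HB.instance Definition _ := GRing.RMorphism.on tpoly.

Lemma tpoly_multS (g : {poly F}) : g != 0 -> tpoly g \in multS F.
Proof. by move=> g0; apply/asboolP; exists g. Qed.

(** A fiber with g(s^2) nonzero detects g(t). *)
Lemma tpoly_neq0 (g : {poly F}) : g != 0 -> tpoly g != 0.
Proof.
move=> g0; have G0 : g \Po 'X^2 != 0 by rewrite comp_poly_eq0 // size_polyXn.
have [n [s [_]]] := destabilizing_avoid chF G0.
rewrite horner_comp hornerXn; apply: contra => /eqP h.
have := rmorph0 (fiber chF s); rewrite -h.
rewrite [tpoly g]/(toR _) (fiber_multS chF) => -[] /eqP.
by rewrite !polyC_eq0.
Qed.

Lemma localized_Rz_neq0 : loc_of (multS F) Rz != 0.
Proof.
apply/eqP => /loc_of_eq0 [w /asboolP [g g0 ew]].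
rewrite mulrC => /Rz_regular w0; move: (tpoly_neq0 g0).
by rewrite -[tpoly g]ew w0 eqxx.
Qed.

Local Notation L := (loc_of (multS F)).

Lemma in_closure_of_localization :
  tight_closure 2 (loc_ideal (multS F) (idealI F)) (loc_of (multS F) (Ry ^+ 3 * Rz ^+ 3)).
Proof.
exists (loc_of (multS F) Rz); split; first exact: localized_Rz_neq0.
move=> e _.
have rel : (Rx ^+ 2 + Ry * Rz) * (Ry ^+ 2 + Rx * Rz) = tpoly 'X * Rz ^+ 4 :> R.
  have -> : tpoly 'X = Rt F by rewrite /tpoly /= /horner_eval map_polyX hornerX.
  by apply: (eq_mod2 (pchar_hypR chF) (c := 0)); rewrite !addr0; apply/esym/eqP;
    rewrite -subr_eq0 (oppr_pchar2 (pchar_hypR chF)); apply/eqP/hyp_relation.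
have [w w0 [a [b [c eabc]]]] := degenerate_membership (pchar_hypR chF) e rel.
rewrite /= in eabc.
(* w varies with e, but w(0) = 1 puts it in S, so it is cancelled in the localization and the
   multiplier z stays the same for all e. *)
have wS : tpoly w \in multS F.
  by apply: tpoly_multS; apply: contra_eq_neq w0 => ->; rewrite horner0 eq_sym oner_neq0.
have [w' ew'] := loc_of_inv wS.
have -> : L Rz * L (Ry ^+ 3 * Rz ^+ 3) ^+ (2 ^ e)
   = w' * L (tpoly w * (Rz * (Ry ^+ 3 * Rz ^+ 3) ^+ (2 ^ e))).
  by rewrite (rmorphM L (tpoly w)) (rmorphM L Rz) (rmorphXn L (2 ^ e)) !mulrA ew' mul1r.
have gen r : [set Rx ^+ 4; Ry ^+ 4; Rz ^+ 4]%classic r ->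
    [set x ^+ (2 ^ e) | x in loc_ideal (multS F) (idealI F)]%classic (L r ^+ (2 ^ e)).
  move=> hr; exists (L r) => //; rewrite -[L r]mul1r; apply: ideal_gen_mem.
  by exists r => //; rewrite -[r]mul1r; apply: ideal_gen_mem.
rewrite eabc !(rmorphD L) (rmorphM L a) (rmorphM L b) (rmorphM L c) !mulrDr !exprM.
rewrite !(rmorphXn L (2 ^ e)) !mulrA.
apply: ideal_genD; first apply: ideal_genD; apply: ideal_gen_mem; apply: gen.
- by left; left.
- by left; right.
- by right.
Qed.
End InClosure.

Theorem mainTheorem1
    (F : closedFieldType) (iota : {rmorphism 'F_2 -> F})
    (F_algebraic : forall u : F, algebraicOver iota u) :
  let S : mulrClosed (hypR F) := multS F in
  let I : set (hypR F) := idealI F in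
  [/\ tight_closure 2 (loc_ideal S I) (loc_of S (Ry ^+ 3 * Rz ^+ 3)),
      ~ loc_ideal S (tight_closure 2 I) (loc_of S (Ry ^+ 3 * Rz ^+ 3)) &
      tight_closure 2 (loc_ideal S I) <> loc_ideal S (tight_closure 2 I)].
Proof.
move=> S I.
have chF : 2%N \in [pchar F].
  by rewrite !inE /= -(rmorph_nat iota) (pcharf0 (pchar_Fp _)) // rmorph0.
have h1 := in_closure_of_localization chF.
have h2 := not_in_localized_closure chF.
by split=> // e; apply: h2; rewrite -e.
Qed.
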